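(* Fix $\Lambda\ge 1$ and set $\tau=\Lambda/(\Lambda+1)$. The partially identified set for $\psi_{\mathrm T}=\mathbb E[Y(1)]$ under the marginal sensitivity model with parameter $\Lambda$ is a closed interval $[\psi_{\mathrm T}^-,\psi_{\mathrm T}^+]$. Moreover its endpoints are the optimal values of the following problems, whose minimum and maximum are attained: $$\psi_{\mathrm T}^-=\min_{\bar E\in\mathcal E_\infty(\Lambda)}\mathbb E[YZ/\bar E]\quad\text{subject to}\quad \mathbb E[Q_{1-\tau}(X,1)Z/\bar E]=\mathbb E[Q_{1-\tau}(X,1)],$$ $$\psi_{\mathrm T}^+=\max_{\bar E\in\mathcal E_\infty(\Lambda)}\mathbb E[YZ/\bar E]\quad\text{subject to}\quad \mathbb E[Q_{\tau}(X,1)Z/\bar E]=\mathbb E[Q_{\tau}(X,1)].$$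
   Context: Observed data $(X,Y,Z)\sim P$ with $X\in\mathcal X\subseteq\mathbb R^d$, $Y\in\mathbb R$, $Z\in\{0,1\}$; the nominal propensity score is $e(x)=P(Z=1\mid X=x)$, and it is assumed that $0<e(X)<1$ almost surely and $\mathbb E|Y|<\infty$. A full-data distribution $Q$ is a law of $(X,Y(0),Y(1),Z,U)$ with $U\in\mathbb R^k$ for some $k\ge1$; it is compatible with $P$ if the law of $(X,ZY(1)+(1-Z)Y(0),Z)$ under $Q$ equals $P$. $Q$ satisfies the marginal sensitivity model with parameter $\Lambda$ if under $Q$, $(Y(0),Y(1))$ is independent of $Z$ given $(X,U)$, and with $e_0(X,U)=Q(Z=1\mid X,U)$ one has $\Lambda^{-1}\le \frac{e_0(X,U)/(1-e_0(X,U))}{e(X)/(1-e(X))}\le\Lambda$ almost surely. The partially identified set for $\psi_{\mathrm T}$ is $\{\mathbb E_Q[Y(1)]: Q \text{ compatible with } P \text{ and satisfying the marginal sensitivity model with parameter }\Lambda\}$. $\mathcal E_\infty(\Lambda)$ is the set of random variables $\bar E$ defined jointly with $(X,Y,Z)$ such that $\Lambda^{-1}\le\frac{\bar E/(1-\bar E)}{e(X)/(1-e(X))}\le\Lambda$ almost surely; unsubscripted expectations are taken jointly with $(X,Y,Z)\sim P$. $F(y\mid x,z)=P(Y\le y\mid X=x,Z=z)$ and $Q_t(x,z)=\inf\{q\in\mathbb R: F(q\mid x,z)\ge t\}$.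
   Formalization: The formal statement additionally assumes E[|Y|Z/e(X)] < ∞; without it every admissible Q has E_Q|Y(1)| = ∞, so no finite mean of Y(1) exists and the identified set of real values is empty, although E|Y| < ∞. *)

(* Defs.v *)
From HB Require Import structures.
From mathcomp Require Import all_boot all_order all_algebra.
From mathcomp Require Import all_classical all_reals all_analysis.
Set Implicit Arguments. Unset Strict Implicit. Unset Printing Implicit Defensive.
Import Order.TTheory GRing.Theory Num.Theory.
Import numFieldNormedType.Exports.
Local Open Scope classical_set_scope.
Local Open Scope ring_scope.

Section defs.
Variable R : realType.

Definition Obs (d : nat) := ((d.-tuple R * R) * bool)%type.
Definition obsX {d} (w : Obs d) : d.-tuple R := w.1.1.
Definition obsY {d} (w : Obs d) : R := w.1.2.
Definition obsZ {d} (w : Obs d) : bool := w.2.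

Definition Full (d k : nat) :=
  ((((d.-tuple R * R) * R) * bool) * k.-tuple R)%type.
Definition fX {d k} (w : Full d k) : d.-tuple R := w.1.1.1.1.
Definition fY0 {d k} (w : Full d k) : R := w.1.1.1.2.
Definition fY1 {d k} (w : Full d k) : R := w.1.1.2.
Definition fZ {d k} (w : Full d k) : bool := w.1.2.
Definition fU {d k} (w : Full d k) : k.-tuple R := w.2.
Definition fXU {d k} (w : Full d k) : (d.-tuple R * k.-tuple R)%type :=
  (fX w, fU w).
Definition fY01 {d k} (w : Full d k) : (R * R)%type := (fY0 w, fY1 w).
Definition fobs {d k} (w : Full d k) : Obs d :=
  ((fX w, if fZ w then fY1 w else fY0 w), fZ w).

Definition is_condprob dO (Om : measurableType dO) (Q : probability Om R)
    d3 (T3 : measurableType d3) (C : Om -> T3) (A : set Om) (g : T3 -> R) :=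
  measurable_fun setT g /\
  forall D, measurable D ->
    Q (A `&` (C @^-1` D)) = (\int[Q]_(w in C @^-1` D) (g (C w))%:E)%E.

Definition cond_indep dO (Om : measurableType dO) (Q : probability Om R)
    d1 (T1 : measurableType d1) d2 (T2 : measurableType d2)
    d3 (T3 : measurableType d3)
    (V : Om -> T1) (W : Om -> T2) (C : Om -> T3) :=
  forall (S : set T1) (T : set T2), measurable S -> measurable T ->
  exists gS gT gST : T3 -> R,
    [/\ is_condprob Q C (V @^-1` S) gS,
        is_condprob Q C (W @^-1` T) gT,
        is_condprob Q C ((V @^-1` S) `&` (W @^-1` T)) gST &
        {ae Q, forall w, gST (C w) = gS (C w) * gT (C w)}].

Definition is_propensity d (P : probability (Obs d) R) (e : d.-tuple R -> R) :=
  is_condprob P obsX [set w | obsZ w] e.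

Definition is_cond_cdf d (P : probability (Obs d) R)
    (F : R -> d.-tuple R -> bool -> R) :=
  [/\ (forall x z, {homo (fun y => F y x z) : a b / a <= b}),
      (forall x z y, F q x z @[q --> y^'+] --> F y x z),
      ((forall x z, F q x z @[q --> -oo] --> (0:R)) /\
       (forall x z, F q x z @[q --> +oo] --> (1:R))),
      (forall y z, measurable_fun setT (fun x => F y x z)) &
      (forall y z (A : set (d.-tuple R)), measurable A ->
         P [set w | A (obsX w) /\ obsZ w = z /\ obsY w <= y] =
         (\int[P]_(w in [set w | A (obsX w) /\ obsZ w = z])
             (F y (obsX w) z)%:E)%E)].

Definition Qt d (F : R -> d.-tuple R -> bool -> R) (t : R) (x : d.-tuple R)
    (z : bool) : R := inf [set q | t <= F q x z].

Definition odds (p : R) : R := p / (1 - p).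

Definition msm_bound (Lam : R) (e0 e : R) : Prop :=
  Lam^-1 <= odds e0 / odds e <= Lam.

Definition compatible d k (Q : probability (Full d k) R)
    (P : probability (Obs d) R) :=
  forall A : set (Obs d), measurable A -> Q (fobs @^-1` A) = P A.

Definition msm d k (Q : probability (Full d k) R) (e : d.-tuple R -> R)
    (Lam : R) :=
  cond_indep Q fY01 fZ fXU /\
  exists e0 : (d.-tuple R * k.-tuple R)%type -> R,
    is_condprob Q fXU [set w | fZ w] e0 /\
    {ae Q, forall w, msm_bound Lam (e0 (fXU w)) (e (fX w))}.

Definition PIset d (P : probability (Obs d) R) (e : d.-tuple R -> R)
    (Lam : R) : set R :=
  [set m | exists k : nat, (0 < k)%N /\
     exists Q : probability (Full d k) R,
       [/\ compatible Q P, msm Q e Lam,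
           Q.-integrable setT (fun w => (fY1 w)%:E) &
           (\int[Q]_w (fY1 w)%:E)%E = m%:E]].

(* E_infty(Lam): joint laws mu of (X, Y, Z, Ebar) whose (X,Y,Z)-marginal is P
   and with the odds-ratio bound holding almost surely. *)
Definition Einf d (P : probability (Obs d) R) (e : d.-tuple R -> R)
    (Lam : R) (mu : probability (Obs d * R)%type R) :=
  (forall A : set (Obs d), measurable A -> mu (fst @^-1` A) = P A) /\
  {ae mu, forall w, msm_bound Lam w.2 (e (obsX w.1))}.

Definition ipw d (mu : probability (Obs d * R)%type R) (g : Obs d -> R) : \bar R :=
  (\int[mu]_w (g w.1 * (obsZ w.1)%:R / w.2)%:E)%E.

Definition qconstr d (P : probability (Obs d) R)
    (mu : probability (Obs d * R)%type R) (q : d.-tuple R -> R) :=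
  ipw mu (fun w => q (obsX w)) = (\int[P]_w (q (obsX w))%:E)%E.

End defs.

(* Main.v *)
(** The idea: write [Y] as [Qt F V X Z] with [V] uniform on (0, 1) and independent
    of [(X, Z)].  A bounded weight [1 / Ebar] may then be taken to be a function of
    [X] and of the latent rank [V], namely [(e + (1 - e) * r V) / e] for a
    tilt [r] of mean 1 with values in [[Lam^-1, Lam]]; ranks have no ties, so
    atoms of [Y] need no special treatment.  The optimal tilts are the two-valued
    ones jumping at the rank of the quantile appearing in the constraint:
    subtracting the constraint replaces [Y] by [Y - Qt], whose sign is known on
    either side of the jump, so that these tilts are optimal pointwise.

    Every tilt also defines a compatible full-data law: give the untreated the
    density [r V1] for the rank [V1] of [Y(1)], draw the rank [V0] of [Y(0)]
    independently, and take [U = (V0, V1)], which with [X] determines both potential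
    outcomes.  The mean of [Y(1)] is affine in [r], hence all intermediate values
    are reached.  Conversely a full-data law satisfying the model yields the joint
    law of the observation and of [e0(X, U)], which is admissible for both
    problems with objective [E[Y(1)]]. *)
Require Import Defs.
From HB Require Import structures.
From mathcomp Require Import all_boot all_order all_algebra.
From mathcomp Require Import all_classical all_reals all_analysis.
From mathcomp Require Import measurable_realfun ring lra.
Import Order.TTheory GRing.Theory Num.Theory.
Import numFieldNormedType.Exports.
Local Open Scope classical_set_scope.
Local Open Scope ring_scope.
Set Implicit Arguments. Unset Strict Implicit. Unset Printing Implicit Defensive.

(** * Measures with a density *)

(** The conditional probabilities in the definitions are known only through their integrals over
    preimages of measurable sets. Every exchange of [Z] for [e(X)], of [Y] for its resampled copy,
    or of an indicator for its conditional probability is therefore an equality of two measures, the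
    images in a common space of measures with a density. Since the densities are nonnegative,
    equality on sets extends to all measurable integrands, signed and not assumed integrable.

    The constant [tau] is forced by the mean-one condition: the values [Lam^-1] on ranks up to [t]
    and [Lam] beyond have mean [t / Lam + (1 - t) * Lam], which for [Lam > 1] is 1 only at
    [t = Lam / (Lam + 1)]; exchanging the two values gives [1 - tau].

    A competitor obeys a single scalar constraint, not [E[Z / Ebar | X] = 1]. This suffices for the
    bound once the quantile is known to be integrable, so that the constraint can be subtracted;
    that integrability is deduced from the one of [Y Z / e]. *)

Section pushforward_density.
Context {dO d : measure_display} {Om : measurableType dO}
  {T : measurableType d} {R : realType}.
Variables (m : {measure set Om -> \bar R}) (C : Om -> T) (f : Om -> R).

(** The image under [C] of the measure with density [f]. The measurability and sign proofs are
    arguments so that the measure structure can be inferred from the term itself. *)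
Definition pushdens of measurable_fun setT C & measurable_fun setT f
    & (forall w, 0 <= f w) : set T -> \bar R :=
  fun D => (\int[m]_(w in C @^-1` D) (f w)%:E)%E.

Hypotheses (mC : measurable_fun setT C) (mf : measurable_fun setT f)
  (f0 : forall w, 0 <= f w).
Local Notation nu := (pushdens mC mf f0).

Let nu0 : nu set0 = 0%E.
Proof. by rewrite /pushdens preimage_set0 integral_set0. Qed.

Let nu_ge0 D : (0 <= nu D)%E.
Proof. by apply: integral_ge0 => w _; rewrite lee_fin. Qed.

Let nu_sigma_additive : semi_sigma_additive nu.
Proof.
move=> D mD tD mUD; rewrite /pushdens; apply: cvg_toP.
  apply: ereal_nondecreasing_is_cvgn => i j ij.
  apply: lee_sum_nneg_natr => // k _ _.
  by apply: integral_ge0 => w _; rewrite lee_fin.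
rewrite preimage_bigcup ge0_integral_bigcup//=.
- by move=> k; rewrite -[_ @^-1` _]setTI; exact: mC.
- by apply/measurable_EFinP; exact: measurable_funTS.
- by move=> w _; rewrite lee_fin.
- by apply/trivIsetP => i j _ _ ij; rewrite -preimage_setI;
    move/trivIsetP : tD => ->//; rewrite preimage_set0.
Qed.

HB.instance Definition _ := isMeasure.Build _ _ _ nu
  nu0 nu_ge0 nu_sigma_additive.

Import HBNNSimple.

Let mCpre D : measurable D -> measurable (C @^-1` D).
Proof. by move=> mD; rewrite -[_ @^-1` _]setTI; exact: mC. Qed.

Let ge0_integral_nu_indic (k : R) D : measurable D -> 0 <= k ->
  (\int[nu]_x (k * \1_D x)%:E = \int[m]_w ((k * \1_D (C w)) * f w)%:E)%E.
Proof.
move=> mD k0; under [RHS]eq_integral do rewrite -mulrA EFinM.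
rewrite [RHS]ge0_integralZl//; last 2 first.
- apply/measurable_EFinP; apply: measurable_funM => //.
  by apply: measurableT_comp => //; exact: measurable_indic.
- by move=> w _; rewrite lee_fin mulr_ge0// indicE.
under [LHS]eq_integral do rewrite EFinM.
rewrite [LHS]ge0_integralZl; [|exact: measurableT| | |by rewrite lee_fin]; last 2 first.
- by apply/measurable_EFinP; exact: measurable_indic.
- by move=> x _; rewrite lee_fin.
rewrite integral_indic// setIT.
congr (_ * _)%E; rewrite /pushdens [LHS]integral_mkcond; apply: eq_integral => w _.
rewrite patchE indicE -[w \in _ @^-1` _]/(C w \in D); case: ifPn => _.
  by rewrite mul1r.
by rewrite mul0r.
Qed.

Lemma ge0_integral_pushdens (h : T -> \bar R) : measurable_fun setT h ->
  (forall x, 0 <= h x)%E ->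
  (\int[nu]_x h x = \int[m]_w (h (C w) * (f w)%:E))%E.
Proof.
move=> mh h0; pose g := nnsfun_approx measurableT mh.
have gh x : EFin \o g ^~ x @ \oo --> h x.
  by apply: cvg_nnsfun_approx => // *; exact: h0.
transitivity (limn (fun n => \int[nu]_x (g n x)%:E)%E).
  rewrite -monotone_convergence//.
  - by apply: eq_integral => x _; apply/esym/cvg_lim => //; exact: gh.
  - by move=> n; exact/measurable_EFinP.
  - by move=> n x _; rewrite lee_fin.
  - by move=> x _ i j ij; rewrite lee_fin; exact/lefP/nd_nnsfun_approx.
transitivity (limn (fun n => \int[m]_w (g n (C w) * f w)%:E)%E); last first.
  rewrite -monotone_convergence//.
  - apply: eq_integral => w _; apply/cvg_lim => //.
    under eq_fun do rewrite EFinM.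
    by apply: cvgeZr => //; exact: gh.
  - move=> n; apply/measurable_EFinP; apply: measurable_funM => //.
    exact: measurableT_comp.
  - by move=> n w _; rewrite lee_fin mulr_ge0.
  - move=> w _ i j ij; rewrite lee_fin ler_wpM2r//.
    exact/lefP/nd_nnsfun_approx.
congr (limn _); apply/funext => n.
transitivity (\sum_(k \in range (g n))
    \int[nu]_x (k * \1_(g n @^-1` [set k]) x)%:E)%E.
  under eq_integral do rewrite fimfunE -fsumEFin//.
  rewrite ge0_integral_fsum//.
  - move=> k; apply/measurable_EFinP/measurable_funM => //.
  - by move=> k x _; exact: nnfun_muleindic_ge0.
transitivity (\sum_(k \in range (g n))
    \int[m]_w ((k * \1_(g n @^-1` [set k]) (C w)) * f w)%:E)%E.
  apply: eq_fsbigr => k; rewrite inE => -[x _ <-].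
  exact: ge0_integral_nu_indic.
rewrite -ge0_integral_fsum//.
- apply: eq_integral => w _.
  by rewrite fsumEFin// fimfunE mulr_fsuml.
- move=> k; apply/measurable_EFinP; apply: measurable_funM => //.
  pose u x := k * \1_(g n @^-1` [set k]) x.
  apply: (@measurableT_comp _ _ _ _ _ _ u _ C) => //.
  by apply: measurable_funM => //; exact: measurable_indic.
- move=> k w _; rewrite EFinM mule_ge0// ?lee_fin//.
  exact: nnfun_muleindic_ge0.
Qed.

(** Multiplying by a nonnegative real commutes with positive and negative parts, so the nonnegative
    case applies to each part and no integrability is required. *)
Lemma integral_pushdens (h : T -> \bar R) : measurable_fun setT h ->
  (\int[nu]_x h x = \int[m]_w (h (C w) * (f w)%:E))%E.
Proof.
move=> mh; rewrite [LHS]integralE [RHS]integralE.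
rewrite !ge0_integral_pushdens//; last 2 first.
- exact: measurable_funeneg.
- exact: measurable_funepos.
by congr (_ - _)%E; apply: eq_integral => w _;
  rewrite ?funeposE ?funenegE -?mulNe maxe_pMl ?mul0e// lee_fin.
Qed.

End pushforward_density.

(** Both sides are integrals of [h] against image measures, which coincide as soon as they agree on
    measurable sets. Set-indexed identities, such as those defining conditional probabilities,
    become identities between integrals in this way. *)
Lemma integral_transfer {R : realType} {d1 d2 d : measure_display}
    {Om1 : measurableType d1} {Om2 : measurableType d2} {T : measurableType d}
    (m1 : {measure set Om1 -> \bar R}) (m2 : {measure set Om2 -> \bar R})
    (C1 : Om1 -> T) (C2 : Om2 -> T) (f1 : Om1 -> R) (f2 : Om2 -> R) :
  measurable_fun setT C1 -> measurable_fun setT C2 ->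
  measurable_fun setT f1 -> measurable_fun setT f2 ->
  (forall w, 0 <= f1 w) -> (forall w, 0 <= f2 w) ->
  (forall D, measurable D -> (\int[m1]_(w in C1 @^-1` D) (f1 w)%:E =
                              \int[m2]_(w in C2 @^-1` D) (f2 w)%:E)%E) ->
  forall h : T -> \bar R, measurable_fun setT h ->
  (\int[m1]_w (h (C1 w) * (f1 w)%:E) = \int[m2]_w (h (C2 w) * (f2 w)%:E))%E.
Proof.
move=> mC1 mC2 mf1 mf2 f10 f20 E h mh.
rewrite -(integral_pushdens m1 mC1 mf1 f10 mh).
rewrite -(integral_pushdens m2 mC2 mf2 f20 mh).
by apply: eq_measure_integral => D mD _; exact: E.
Qed.

Lemma probability_with_density {R : realType} {dO d : measure_display}
    {Om : measurableType dO} {T : measurableType d}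
    (m : {measure set Om -> \bar R}) (C : Om -> T) (f : Om -> R) :
  measurable_fun setT C -> measurable_fun setT f -> (forall w, 0 <= f w) ->
  (\int[m]_w (f w)%:E = 1)%E ->
  exists Q : probability T R,
    (forall D, measurable D -> Q D = \int[m]_(w in C @^-1` D) (f w)%:E)%E /\
    (forall h : T -> \bar R, measurable_fun setT h ->
      \int[Q]_x h x = \int[m]_w (h (C w) * (f w)%:E))%E.
Proof.
move=> mC mf f0 f1.
pose isP := @Measure_isProbability.Build _ _ R (pushdens m mC mf f0) f1.
pose Q : probability T R := HB.pack (pushdens m mC mf f0) isP.
by exists Q; split => // h mh; exact: (integral_pushdens m mC mf f0 mh).
Qed.

Lemma integral_law {R : realType} {dO d : measure_display}
    {Om : measurableType dO} {T : measurableType d}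
    (m : {measure set Om -> \bar R}) (n : {measure set T -> \bar R}) (C : Om -> T) :
  measurable_fun setT C ->
  (forall D, measurable D -> n D = m (C @^-1` D)) ->
  forall h : T -> \bar R, measurable_fun setT h ->
  (\int[n]_x h x = \int[m]_w h (C w))%E.
Proof.
move=> mC E h mh.
have mCpre D : measurable D -> measurable (C @^-1` D).
  by move=> mD; rewrite -[_ @^-1` _]setTI; exact: mC.
under eq_integral do rewrite -[h _]mule1.
under [RHS]eq_integral do rewrite -[h _]mule1.
apply: (@integral_transfer _ _ _ _ _ _ _ n m id C (fun=> 1) (fun=> 1)) => //.
by move=> D mD; rewrite !integral_cst// ?mul1e ?E//; exact: mCpre.
Qed.

Lemma integral_boolR {R : realType} {dO : measure_display}
    {Om : measurableType dO} (m : {measure set Om -> \bar R}) (b : Om -> bool)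
    (A : set Om) : measurable_fun setT b -> measurable A ->
  (\int[m]_(w in A) (b w)%:R%:E = m ([set w | b w] `&` A))%E.
Proof.
move=> mb mA.
have mB : measurable [set w | b w].
  by rewrite -[X in measurable X]setTI; exact: (mb measurableT [set true]).
rewrite -[RHS]integral_indic//; apply: eq_integral => w _; rewrite indicE.
case: (boolP (b w)) => bw; first by rewrite mem_set.
by rewrite memNset//=; exact/negP.
Qed.

Lemma measurable_preimageT {dO d : measure_display} {Om : measurableType dO}
    {T : measurableType d} (C : Om -> T) (D : set T) :
  measurable_fun setT C -> measurable D -> measurable (C @^-1` D).
Proof. by move=> mC mD; rewrite -[_ @^-1` _]setTI; exact: mC. Qed.

Lemma measurable_is_true {d : measure_display} {T : measurableType d}
    (b : T -> bool) : measurable_fun setT b -> measurable [set x | b x].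
Proof.
by move=> mb; rewrite -[X in measurable X]setTI; exact: (mb measurableT [set true]).
Qed.

(** * Conditional probabilities as image densities *)

Section condprob.
Context {R : realType} {dO d : measure_display} {Om : measurableType dO}
  {T : measurableType d} (Q : probability Om R) (C : Om -> T) (A : set Om).
Hypotheses (mC : measurable_fun setT C) (mA : measurable A).

(** On the event where [g] is negative, the integral of its absolute value is minus a probability,
    hence zero. *)
Lemma ae_condprob_ge0 (g : T -> R) : is_condprob Q C A g ->
  {ae Q, forall w, 0 <= g (C w)}.
Proof.
move=> [mg E].
have mgN : measurable [set x | g x < 0].
  by apply: measurable_is_true; exact: measurable_fun_ltr.
set N := C @^-1` [set x | g x < 0].
have mN : measurable N by exact: measurable_preimageT.
have mgC : measurable_fun setT (g \o C) by exact: measurableT_comp.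
have I0 : (\int[Q]_(w in N) `|(g (C w))%:E| = 0)%E.
  apply/eqP; rewrite eq_le integral_ge0// andbT -oppe_ge0 -integral_ge0N//.
  rewrite (eq_integral (fun w => (g (C w))%:E)) -?E//.
  by move=> w; rewrite inE /N/= => gw; rewrite ltr0_norm// opprK.
move/ae_eq_integral_abs : I0 => /(_ mN) I0.
have {}I0 : ae_eq Q N (fun w => (g (C w))%:E) (cst 0%E).
  by apply: I0; apply/measurable_EFinP; exact: measurable_funTS.
apply: filterS I0 => w /= gw; rewrite leNgt; apply/negP => gw0.
by have [gE] := gw gw0; rewrite gE ltxx in gw0.
Qed.

Lemma condprob_ae_eq (g g' : T -> R) : is_condprob Q C A g ->
  measurable_fun setT g' -> {ae Q, forall w, g' (C w) = g (C w)} ->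
  is_condprob Q C A g'.
Proof.
move=> [mg E] mg' gg'; split => // D mD; rewrite E//.
apply: ae_eq_integral.
- exact: measurable_preimageT.
- by apply/measurable_EFinP/measurable_funTS; exact: measurableT_comp.
- by apply/measurable_EFinP/measurable_funTS; exact: measurableT_comp.
- by apply: filterS gg' => w /= ->.
Qed.

(** Densities have to be nonnegative everywhere, whereas a conditional probability is so only almost
    surely; truncation at 0 gives an admissible version. *)
Lemma condprob_nneg (g : T -> R) : is_condprob Q C A g ->
  exists g' : T -> R, [/\ is_condprob Q C A g', forall x, 0 <= g' x &
    {ae Q, forall w, g' (C w) = g (C w)}].
Proof.
move=> Hg; have [mg _] := Hg.
have gg' : {ae Q, forall w, Num.max 0 (g (C w)) = g (C w)}.
  by apply: filterS (ae_condprob_ge0 Hg) => w gw; exact/max_idPr.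
exists (fun x => Num.max 0 (g x)); split => //.
- by apply: condprob_ae_eq Hg _ gg'; exact: measurable_maxr.
- by move=> x; rewrite le_max lexx.
Qed.

(** The tower property: the weights [\1_A] and [g (C w)] have the same image under [C]. *)
Lemma integral_condprob (g : T -> R) (h : T -> \bar R) :
  is_condprob Q C A g -> (forall x, 0 <= g x) -> measurable_fun setT h ->
  (\int[Q]_w (h (C w) * (\1_A w)%:E) = \int[Q]_w (h (C w) * (g (C w))%:E))%E.
Proof.
move=> [mg E] g0 mh; apply: integral_transfer => //.
- exact: measurableT_comp.
- move=> D mD; have mD' : measurable (C @^-1` D) by exact: measurable_preimageT.
  by rewrite integral_indic//; exact: E.
Qed.

End condprob.

(** * Measurability of elementary operations *)

Lemma measurable_inv {R : realType} :
  measurable_fun [set: R] (fun x : R => x^-1).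
Proof.
(* The inverse is odd and is the power with exponent -1 on nonnegative reals; at 0 both conventions
   give 0. *)
rewrite (_ : (fun x => _) = fun x : R =>
    if 0 <= x then x `^ (-1) else - ((- x) `^ (-1))); last first.
  apply/funext => x; case: ifPn => [x0|]; first by rewrite powR_inv1.
  by rewrite -ltNge => x0; rewrite powR_inv1 ?oppr_ge0 ?ltW// invrN opprK.
apply: measurable_fun_ifT.
- exact: measurable_fun_ler.
- exact: measurable_powR.
- apply: measurable_funN.
  have mN : measurable_fun [set: R] (fun x : R => - x) by exact: measurable_funN.
  exact: (measurableT_comp (measurable_powR (-1)) mN).
Qed.

Lemma measurable_funV {R : realType} {d : measure_display}
    {T : measurableType d} (f : T -> R) :
  measurable_fun setT f -> measurable_fun setT (fun x => (f x)^-1).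
Proof. by move=> mf; apply: (measurableT_comp measurable_inv). Qed.

Lemma measurable_boolR {R : realType} {d : measure_display}
    {T : measurableType d} (b : T -> bool) :
  measurable_fun setT b -> measurable_fun setT (fun x => (b x)%:R : R).
Proof.
move=> mb; rewrite (_ : (fun x => _) = fun x => if b x then 1 else 0 : R).
  exact: measurable_fun_ifT.
by apply/funext => x; case: (b x).
Qed.

Lemma measurable_pair_slice {d1 d2 : measure_display} {T1 : measurableType d1}
    {T2 : measurableType d2} (A : set (T1 * T2)) y :
  measurable A -> measurable [set x | A (x, y)].
Proof.
by move=> mA; apply: (@measurable_preimageT _ _ _ _ (fun x => (x, y))).
Qed.

(** * Uniqueness of measures and the uniform law *)

Lemma uniform01 (R : realType) : exists lam : probability R R,
  (forall c : R, 0 <= c <= 1 -> lam [set v | v <= c] = c%:E) /\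
  {ae lam, forall v, 0 < v < 1}.
Proof.
(* [uniform_prob] lives on [measurableTypeR R]; its image under the identity, with density 1, is a
   law on [R]. *)
have mid : measurable_fun setT (fun v : measurableTypeR R => v : R) by [].
have I1 : (\int[uniform_prob (@ltr01 R)]_w (1 : R)%:E = 1)%E.
  by rewrite integral_cst// mul1e; exact: probability_setT.
have mone : measurable_fun setT (fun v : measurableTypeR R => 1 : R) by [].
have [lam [lamE _]] := probability_with_density mid mone (fun=> ler01) I1.
have {}lamE D : measurable D ->
    lam D = lebesgue_measure (D `&` `[0, 1]%classic).
  move=> mD; rewrite lamE// integral_cst// mul1e.
  rewrite -[LHS]/(uniform_prob (@ltr01 R) D) /uniform_prob.
  rewrite integral_uniform_pdf (eq_integral (cst 1%E)); last first.
    move=> x; rewrite inE => -[_] /= x01.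
    by move: x01; rewrite in_itv/= /uniform_pdf => ->; rewrite subr0 invr1.
  by rewrite integral_cst ?mul1e//; exact: measurableI.
have mc (c : R) : measurable [set v | v <= c].
  by rewrite -set_itvNyc; exact: measurable_itv.
have lamc c : 0 <= c <= 1 -> lam [set v | v <= c] = c%:E.
  move=> /andP[c0 c1]; rewrite lamE//.
  rewrite (_ : _ `&` _ = `[0, c]%classic); last first.
    apply/seteqP; split => x /=; rewrite !in_itv/=.
      by move=> [xc /andP[-> _]]; rewrite xc.
    by move=> /andP[-> xc]; rewrite xc (le_trans xc c1).
  rewrite lebesgue_measure_itv/= lte_fin.
  by rewrite oppr0 adde0; case: ltgtP c0 => // <-.
exists lam; split => //.
have mg : measurable [set v : R | 1 <= v].
  by rewrite -set_itvcy; exact: measurable_itv.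
exists ([set v | v <= 0] `|` [set v | 1 <= v]); split.
- exact: measurableU.
- apply/eqP; rewrite eq_le measure_ge0 andbT.
  apply: le_trans (measureU2 _ _ _) _ => //.
  have l0 : lam [set v : R | v <= 0] = 0%E by rewrite lamc// lexx ler01.
  have l1 : lam [set v : R | 1 <= v] = 0%E; last first.
    by rewrite -[leRHS]adde0; apply: leeD; rewrite le_eqVlt; apply/orP; left;
      apply/eqP; [exact: l0|exact: l1].
  rewrite lamE// (_ : _ `&` _ = `[1, 1]%classic); last first.
    apply/seteqP; split => x /=; rewrite !in_itv/=.
      by move=> [-> /andP[_ ->]].
    move=> /andP[x1 ->]; rewrite x1 andbT; split => //; exact: le_trans ler01 x1.
  by rewrite lebesgue_measure_itv/= ltxx.
- move=> v /= /negP; rewrite negb_and -!leNgt => /orP[]; by [left|right].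
Qed.

Section measure_uniqueness.
Context {R : realType}.

Lemma eq_measure_rays (m1 m2 : {measure set R -> \bar R}) :
  (m1 setT < +oo)%E -> (forall c : R, m1 [set y | y <= c] = m2 [set y | y <= c]) ->
  forall B, measurable B -> m1 B = m2 B.
Proof.
move=> fm1 m12 B mB.
pose G : set (set R) := [set B | exists c : R, B = [set y | y <= c]].
apply: (measure_unique G (fun n => [set y : R | y <= n%:R])) => //.
- rewrite -[LHS]/(@measurable _ (measurableTypeR R)) eqEsubset; split.
    rewrite [X in X `<=` _]RGenOInfty.measurableE.
    apply: smallest_sub; first exact: smallest_sigma_algebra.
    move=> _ [x ->]; rewrite -[X in _ X]setCK.
    apply: sigma_algebraC; apply: sub_sigma_algebra; exists x.
    by rewrite setCitvr set_itvNyc.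
  apply: smallest_sub; first exact: sigma_algebra_measurable.
  by move=> _ [c ->]; rewrite -set_itvNyc; exact: measurable_itv.
- move=> _ _ [a ->] [b ->]; exists (Num.min a b); apply/seteqP.
  by split => y /=; rewrite le_min => /andP.
- by move=> n; exists n%:R.
- apply/seteqP; split => // y _; exists (Num.bound `|y|) => //=.
  by apply: ltW; apply: le_lt_trans (ler_norm y) _; exact: archi_boundP.
- by move=> _ [c ->]; exact: m12.
- move=> k; apply: le_lt_trans fm1; apply: le_measure; rewrite ?inE//.
  by rewrite -set_itvNyc; exact: measurable_itv.
Qed.

Context {d1 d2 : measure_display} {T1 : measurableType d1} {T2 : measurableType d2}.

Lemma eq_measure_rectangles (m1 m2 : {measure set (T1 * T2) -> \bar R}) :
  (m1 setT < +oo)%E ->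
  (forall A B, measurable A -> measurable B -> m1 (A `*` B) = m2 (A `*` B)) ->
  forall A, measurable A -> m1 A = m2 A.
Proof.
move=> fm1 m12 X mX.
pose C : set (set (T1 * T2)) :=
  [set C | exists A, measurable A /\ exists B, measurable B /\ C = A `*` B].
apply: (measure_unique C (fun=> setT)) => //.
- rewrite measurable_prod_measurableType //; congr (<<s _ >>).
  rewrite predeqE; split => [[A mA [B mB <-]]|[A [mA [B [mB ->]]]]].
    by exists A; split => //; exists B.
  by exists A => //; exists B.
- move=> /= _ _ [X1 [mX1 [X2 [mX2 ->]]]] [Y1 [mY1 [Y2 [mY2 ->]]]].
  rewrite -setXI; exists (X1 `&` Y1); split; first exact: measurableI.
  by exists (X2 `&` Y2); split => //; exact: measurableI.
- by move=> n; exists setT; split => //; exists setT; rewrite setXTT.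
- by rewrite bigcup_const.
- by move=> _ [A [mA [B [mB ->]]]]; exact: m12.
Qed.

End measure_uniqueness.

Section joint_uniqueness.
Context {R : realType} {d : measure_display} {T : measurableType d}.

(** For fixed [A], the map sending [D] to [m (A x D)] is a measure on the line, namely the image
    under the second projection of the density [\1_(A x R)]. Uniqueness on rays extends it from rays
    to all [D], and rectangles then determine the measure. *)
Lemma eq_measure_strips (m1 m2 : {measure set (T * R) -> \bar R}) :
  (m1 setT < +oo)%E ->
  (forall A (c : R), measurable A -> m1 (A `*` [set y | y <= c]) = m2 (A `*` [set y | y <= c])) ->
  forall A, measurable A -> m1 A = m2 A.
Proof.
move=> fm1 m12; apply: eq_measure_rectangles => // A B mA mB.
have mf : measurable_fun setT (\1_(A `*` setT) : T * R -> R).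
  by apply: measurable_indic; exact: measurableX.
have f0 (p : T * R) : 0 <= \1_(A `*` setT) p :> R by [].
have pE (m : {measure set (T * R) -> \bar R}) D : measurable D ->
    pushdens m measurable_snd mf f0 D = m (A `*` D).
  move=> mD; rewrite /pushdens integral_indic//=.
  - by congr (m _); apply/seteqP; split => -[x y]/= [] // [].
  - by rewrite -[X in measurable X]setTI; exact: measurable_snd.
  - exact: measurableX.
rewrite -!pE//; apply: eq_measure_rays => // [|c].
  rewrite [X in (X < _)%E](pE m1 setT)//; apply: le_lt_trans fm1.
  by apply: le_measure; rewrite ?inE//; exact: measurableX.
have mc : measurable [set v : R | v <= c].
  by rewrite -set_itvNyc; exact: measurable_itv.
by rewrite [LHS](pE m1 _ mc) [RHS](pE m2 _ mc) m12.
Qed.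

(** The same device is applied to the restriction to each value of the Boolean; a measurable set is
    the disjoint union of its two slices. *)
Lemma eq_measure_strips_bool (m1 m2 : {measure set (T * R * bool) -> \bar R}) :
  (m1 setT < +oo)%E ->
  (forall A (c : R) z, measurable A ->
    m1 (A `*` [set y | y <= c] `*` [set z]) = m2 (A `*` [set y | y <= c] `*` [set z])) ->
  forall A, measurable A -> m1 A = m2 A.
Proof.
move=> fm1 m12 A mA.
have mS z : measurable (setT `*` [set z] : set (T * R * bool)) by exact: measurableX.
have mf z : measurable_fun setT (\1_(setT `*` [set z]) : T * R * bool -> R).
  exact: measurable_indic.
have f0 z (p : T * R * bool) : 0 <= \1_(setT `*` [set z]) p :> R by [].
have pE (m : {measure set (T * R * bool) -> \bar R}) z D : measurable D ->
    pushdens m measurable_fst (mf z) (f0 z) D = m (D `*` [set z]).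
  move=> mD; rewrite /pushdens integral_indic//=.
  - by congr (m _); apply/seteqP; split => -[x y]/= [] // [].
  - by rewrite -[X in measurable X]setTI; exact: measurable_fst.
have E z D : measurable D -> m1 (D `*` [set z]) = m2 (D `*` [set z]).
  move=> mD; rewrite -!pE//; apply: eq_measure_strips => // [|B c mB].
    rewrite [X in (X < _)%E](pE m1 z setT)//; apply: le_lt_trans fm1.
    by apply: le_measure; rewrite ?inE//; exact: measurableX.
  have mc : measurable [set v : R | v <= c].
    by rewrite -set_itvNyc; exact: measurable_itv.
  have mBc : measurable (B `*` [set v : R | v <= c]) by exact: measurableX.
  by rewrite [LHS](pE m1 z _ mBc) [RHS](pE m2 z _ mBc) m12.
have mAz z : measurable [set p | A (p, z)] by exact: measurable_pair_slice.
have AE : A = [set p | A (p, true)] `*` [set true] `|` [set p | A (p, false)] `*` [set false].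
  apply/seteqP; split => [[p [|]] Ap /=|[p z] /= [] [] Ap ->] //; by [left|right].
have U (m : {measure set (T * R * bool) -> \bar R}) : m A =
    (m ([set p | A (p, true)] `*` [set true]) +
     m ([set p | A (p, false)] `*` [set false]))%E.
  rewrite {1}AE measureU//; [exact: measurableX|exact: measurableX|].
  by apply/seteqP; split => // -[p z] /= [[_ ->] [_]].
by rewrite [LHS]U [RHS]U; congr (_ + _)%E; exact: E.
Qed.

End joint_uniqueness.

(** * Conditional quantiles and resampling *)

Lemma measurable_fun_rays {R : realType} {d : measure_display}
    {T : measurableType d} (f : T -> R) :
  (forall c, measurable [set x | f x <= c]) -> measurable_fun setT f.
Proof.
move=> mf; apply: (@measurability _ _ _ _ _ _ (@RGenOInfty.G R)).
  exact: RGenOInfty.measurableE.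
move=> _ [_ [x ->] <-]; rewrite setTI.
rewrite (_ : _ @^-1` _ = ~` [set w | f w <= x]); first exact: measurableC.
by apply/seteqP; split => w /=; rewrite in_itv/= andbT ltNge => /negP.
Qed.

Lemma ae_eq_measure {R : realType} {d : measure_display}
    {T : measurableType d} (m : {measure set T -> \bar R}) (A B : set T) :
  measurable A -> measurable B -> {ae m, forall w, A w <-> B w} -> m A = m B.
Proof.
move=> mA mB AB; rewrite -[A]setIT -[B]setIT -!integral_indic//.
apply: ae_eq_integral => //.
- by apply/measurable_EFinP; exact: measurable_indic.
- by apply/measurable_EFinP; exact: measurable_indic.
- apply: filterS AB => w AB _; rewrite !indicE.
  by have -> : (w \in A) = (w \in B) by apply/idP/idP; rewrite !inE => /AB.
Qed.

Section observed.
Context {R : realType} {d : nat}.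

Lemma measurable_obsX : measurable_fun setT (@obsX R d).
Proof. exact: (measurableT_comp measurable_fst measurable_fst). Qed.

Lemma measurable_obsY : measurable_fun setT (@obsY R d).
Proof. exact: (measurableT_comp measurable_snd measurable_fst). Qed.

Lemma measurable_obsZ : measurable_fun setT (@obsZ R d).
Proof. exact: measurable_snd. Qed.

End observed.

Section quantile.
Context {R : realType} {d : nat} (P : probability (Obs R d) R)
  (F : R -> d.-tuple R -> bool -> R).
Hypothesis cdfF : is_cond_cdf P F.

Lemma cond_cdf_ge0 y x z : 0 <= F y x z.
Proof.
have [nd _ [lo _] _ _] := cdfF.
rewrite leNgt; apply/negP => Fy0.
have /filter_ex[q [yq qy]] : \forall q \near -oo, F y x z < F q x z /\ q <= y.
  by apply: filterI; [exact: (cvgr_gt _ (lo x z))|exact: nbhs_ninfty_le (num_real _)].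
by have := lt_le_trans yq (nd x z _ _ qy); rewrite ltxx.
Qed.

Lemma cond_cdf_le1 y x z : F y x z <= 1.
Proof.
have [nd _ [_ hi] _ _] := cdfF.
rewrite leNgt; apply/negP => Fy1.
have /filter_ex[q [yq qy]] : \forall q \near +oo, F q x z < F y x z /\ y <= q.
  by apply: filterI; [exact: (cvgr_lt _ (hi x z))|exact: nbhs_pinfty_ge (num_real _)].
by have := le_lt_trans (nd x z _ _ qy) yq; rewrite ltxx.
Qed.

(** The Galois connection between quantile and distribution function. For [t] in (0, 1) the limits
    of [F] make the set under the infimum nonempty and bounded below. If [F q x z < t], right
    continuity keeps the inequality at some [r > q]; this [r] is a lower bound, so the infimum
    exceeds [q]. *)
Lemma Qt_le t x z q : 0 < t < 1 -> (Qt F t x z <= q) = (t <= F q x z).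
Proof.
have [nd rc [lo hi] _ _] := cdfF.
move=> /andP[t0 t1]; set E := [set r | t <= F r x z].
have E0 : E !=set0.
  have /filter_ex[r tr] : \forall r \near +oo, t < F r x z.
    exact: (cvgr_gt _ (hi x z)).
  by exists r; exact: ltW.
have Elb : has_lbound E.
  have /filter_ex[r rt] : \forall r \near -oo, F r x z < t.
    exact: (cvgr_lt _ (lo x z)).
  exists r => s Es; rewrite leNgt; apply/negP => sr.
  by have := le_lt_trans (le_trans Es (nd x z _ _ (ltW sr))) rt; rewrite ltxx.
apply/idP/idP => [infq|Eq]; last exact: ge_inf.
rewrite leNgt; apply/negP => qt.
have qt' : \forall r \near q^'+, F r x z < t by exact: (cvgr_lt _ (rc x z q)).
have qr' : \forall r \near q^'+, F r x z < t /\ q < r.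
  exact: filterI qt' (nbhs_right_gt q).
have [r [rt qr]] := @filter_ex _ _ (at_right_proper_filter q) _ qr'.
have : r <= inf E.
  apply: lb_le_inf => // s Es; rewrite leNgt; apply/negP => sr.
  by have := le_lt_trans (le_trans Es (nd x z _ _ (ltW sr))) rt; rewrite ltxx.
by move=> /(lt_le_trans qr)/lt_le_trans/(_ infq); rewrite ltxx.
Qed.

Lemma le_Qt s t x z : 0 < s -> s <= t -> t < 1 -> Qt F s x z <= Qt F t x z.
Proof.
move=> s0 st t1.
have t01 : 0 < t < 1 by rewrite (lt_le_trans s0 st).
have s01 : 0 < s < 1 by rewrite s0 (le_lt_trans st t1).
by rewrite Qt_le// (le_trans st)// -Qt_le.
Qed.

(* The value [0] outside (0, 1), where [Qt] is not a quantile, is immaterial: the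
   rank [v] lies in (0, 1) almost surely. *)
Definition qtf (v : R) (x : d.-tuple R) (z : bool) : R :=
  if 0 < v < 1 then Qt F v x z else 0.

Lemma qtf_leE v x z c :
  (qtf v x z <= c) = (if 0 < v < 1 then v <= F c x z else 0 <= c).
Proof. by rewrite /qtf; case: ifPn => // v01; rewrite Qt_le. Qed.

(** The Galois connection turns sublevel sets at [c] into [v <= F c x z], so measurability of [F] in
    [x] at fixed [c] yields joint measurability in [x] and [v]. *)
Lemma measurable_qtf z :
  measurable_fun setT (fun p : d.-tuple R * R => qtf p.2 p.1 z).
Proof.
have [_ _ _ mF _] := cdfF.
apply: measurable_fun_rays => c; under eq_set do rewrite qtf_leE.
have m2 : measurable_fun setT (fun p : d.-tuple R * R => p.2) by exact: measurable_snd.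
apply: measurable_is_true; apply: measurable_fun_ifT => //.
- by apply: measurable_and; exact: measurable_fun_ltr.
- apply: measurable_fun_ler => //.
  exact: (measurableT_comp (mF c z) measurable_fst).
Qed.

(** The rank is drawn first and the outcome computed from it. A rank never has to be extracted from
    [Y], which would require randomization at atoms. *)
Definition resample (p : Obs R d * R) : Obs R d :=
  ((obsX p.1, qtf p.2 (obsX p.1) (obsZ p.1)), obsZ p.1).

Lemma measurable_resample : measurable_fun setT resample.
Proof.
have mX : measurable_fun setT (fun p : Obs R d * R => obsX p.1).
  exact: (measurableT_comp measurable_obsX measurable_fst).
have mZ : measurable_fun setT (fun p : Obs R d * R => obsZ p.1).
  exact: (measurableT_comp measurable_obsZ measurable_fst).
have mH z : measurable_fun setT (fun p : Obs R d * R => qtf p.2 (obsX p.1) z).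
  have mXv : measurable_fun setT (fun p : Obs R d * R => (obsX p.1, p.2)).
    by apply: measurable_fun_pair => //; exact: measurable_snd.
  exact: (measurableT_comp (measurable_qtf z) mXv).
apply: measurable_fun_pair => //; apply: measurable_fun_pair => //.
rewrite (_ : (fun p => _) = fun p : Obs R d * R => if obsZ p.1
    then qtf p.2 (obsX p.1) true else qtf p.2 (obsX p.1) false).
  exact: measurable_fun_ifT.
by apply/funext => p; case: (obsZ p.1).
Qed.

Variable lam : probability R R.
Hypothesis lamE : forall c : R, 0 <= c <= 1 -> lam [set v | v <= c] = c%:E.
Hypothesis lam01 : {ae lam, forall v, 0 < v < 1}.

Lemma law_qtf x z c : lam [set v | qtf v x z <= c] = (F c x z)%:E.
Proof.
rewrite -lamE; last by rewrite cond_cdf_ge0 cond_cdf_le1.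
apply: ae_eq_measure.
- have mH : measurable_fun setT (fun v : R => qtf v x z).
    exact: (measurableT_comp (measurable_qtf z) (@measurable_pair1 _ _ _ _ x)).
  by apply: measurable_is_true; exact: measurable_fun_ler.
- by apply: measurable_is_true; exact: measurable_fun_ler.
- by apply: filterS lam01 => v v01 /=; rewrite qtf_leE v01.
Qed.

(** On a strip [B x ]-oo, c] x {z}] both measures equal the integral of [F c] over the event [X] in
    [B], [Z = z]: one by definition of the conditional distribution function, the other by inverse
    transform sampling on each section. *)
Lemma resample_law A : measurable A -> P A = (P \x lam)%E (resample @^-1` A).
Proof.
have [_ _ _ mF FE] := cdfF.
have m1 : measurable_fun setT (fun p : Obs R d * R => 1 : R) by [].
have mE D : measurable D -> pushdens (P \x lam)%E measurable_resample m1 (fun=> ler01) D =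
    (P \x lam)%E (resample @^-1` D).
  move=> mD; rewrite /pushdens integral_cst ?mul1e//.
  by apply: measurable_preimageT => //; exact: measurable_resample.
move=> mA; rewrite -mE//; apply: eq_measure_strips_bool => //.
  apply: (@le_lt_trans _ _ 1%E); last exact: ltry.
  exact: probability_le1.
move=> B c z mB.
have mc : measurable [set v : R | v <= c].
  by rewrite -set_itvNyc; exact: measurable_itv.
have mS : measurable (B `*` [set v : R | v <= c] `*` [set z]).
  by apply: measurableX => //; exact: measurableX.
rewrite [RHS](mE _ mS).
transitivity (P [set w | B (obsX w) /\ obsZ w = z /\ obsY w <= c]).
  by congr (P _); apply/seteqP; split => -[[x y] z'] /=; [move=> [[]]|move=> [? []]].
rewrite FE// [LHS]integral_mkcond; apply: eq_integral => w _.
rewrite patchE /=; case: ifPn => [|wB].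
  rewrite inE/= => -[Bw zw]; rewrite -law_qtf; congr (lam _).
  apply/seteqP; split => v; rewrite /xsection/= inE/= /resample/= zw.
    by move=> ?.
  by move=> [[]].
rewrite (_ : xsection _ w = set0) ?measure0//.
apply/seteqP; split => // v; rewrite /xsection/= inE/= => -[[Bw _] zw].
by move/negP: wB; rewrite inE/=; apply.
Qed.

End quantile.

(** * The propensity score *)

(** The tactic only peels off arithmetic and conditionals. Measurability of the atoms, such as
    [obsZ p.1], must be in the context, hence the facts stated before its uses. *)
Ltac meas := repeat first [ assumption | exact: measurable_cst
  | apply: measurable_funB | apply: measurable_funM | apply: measurable_funD
  | apply: measurable_funV | apply: measurable_boolR
  | apply: measurable_fun_ifT
  | apply/measurable_EFinP ].

Lemma adde_fin_injl {R : realType} (x y z : \bar R) :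
  x \is a fin_num -> (x + y = x + z)%E -> y = z.
Proof.
by move=> fx E; rewrite -(@addeK _ x y)// -(@addeK _ x z)// ![(_ + x)%E]addeC E.
Qed.

Section propensity.
Context {R : realType} {d : nat} (P : probability (Obs R d) R)
  (e : d.-tuple R -> R).
Hypothesis he : is_propensity P e.
Hypothesis e01 : forall x, 0 < e x < 1.

Let mEc := he.1.

Let e_ge0 x : 0 <= e x. Proof. by have /andP[/ltW] := e01 x. Qed.
Let e_le1 x : 0 <= 1 - e x.
Proof. by rewrite subr_ge0; have /andP[_ /ltW] := e01 x. Qed.

(** The weight is affine in the indicator of treatment, so it suffices to exchange [Z] for [e(X)]
    and [1 - Z] for [1 - e(X)] on events in [X]. The second exchange follows from the first by
    subtraction from a finite total mass. *)
Lemma integral_propensity (c1 c0 : R) (h : d.-tuple R -> \bar R) :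
  0 <= c1 -> 0 <= c0 -> measurable_fun setT h ->
  (\int[P]_w (h (obsX w) * (if obsZ w then c1 else c0)%:E) =
   \int[P]_w (h (obsX w) * (e (obsX w) * c1 + (1 - e (obsX w)) * c0)%:E))%E.
Proof.
move=> c10 c00.
have mX := @measurable_obsX R d; have mZ := @measurable_obsZ R d.
have meX : measurable_fun setT (fun w : Obs R d => e (obsX w)).
  exact: (measurableT_comp mEc mX).
apply: integral_transfer => //.
- by meas.
- by meas.
- by move=> w; case: ifP.
- by move=> w; rewrite addr_ge0// mulr_ge0.
move=> D mD; have mXD := measurable_preimageT mX mD.
have intZ : (\int[P]_(w in @obsX R d @^-1` D) ((obsZ w)%:R : R)%:E =
             \int[P]_(w in @obsX R d @^-1` D) (e (obsX w))%:E)%E.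
  by rewrite integral_boolR//; exact: he.2.
have intNZ : (\int[P]_(w in @obsX R d @^-1` D) (1 - (obsZ w)%:R : R)%:E =
             \int[P]_(w in @obsX R d @^-1` D) (1 - e (obsX w) : R)%:E)%E.
  have tot (u : Obs R d -> R) : measurable_fun setT u -> (forall w, 0 <= u w) ->
      (forall w, 0 <= 1 - u w) ->
      (\int[P]_(w in @obsX R d @^-1` D) (u w)%:E +
       \int[P]_(w in @obsX R d @^-1` D) (1 - u w)%:E = P (@obsX R d @^-1` D))%E.
    move=> mu u0 u1; rewrite -ge0_integralD//.
    - under eq_integral do rewrite -EFinD addrCA subrr addr0.
      by rewrite integral_cst// mul1e.
    - by move=> w _; rewrite lee_fin.
    - by apply/measurable_EFinP; exact: measurable_funTS.
    - by move=> w _; rewrite lee_fin.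
    - by apply/measurable_EFinP; apply: measurable_funTS; meas.
  have t1 : (\int[P]_(w in @obsX R d @^-1` D) ((obsZ w)%:R : R)%:E +
      \int[P]_(w in @obsX R d @^-1` D) (1 - (obsZ w)%:R : R)%:E = P (@obsX R d @^-1` D))%E.
    apply: tot => //; first by meas.
    by move=> w; case: (obsZ w); rewrite ?subrr ?subr0.
  have t2 := tot _ meX (fun w => e_ge0 _) (fun w => e_le1 _).
  have fin : (\int[P]_(w in @obsX R d @^-1` D) (e (obsX w))%:E \is a fin_num)%E.
    rewrite -intZ integral_boolR// fin_num_measure//.
    by apply: measurableI => //; exact: measurable_is_true.
  by apply: (adde_fin_injl fin); rewrite t2 -intZ.
have split_int (u : Obs R d -> R) : measurable_fun setT u ->
    (forall w, 0 <= u w) -> (forall w, 0 <= 1 - u w) ->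
    (\int[P]_(w in @obsX R d @^-1` D) (u w * c1 + (1 - u w) * c0)%:E =
     c1%:E * (\int[P]_(w in @obsX R d @^-1` D) (u w)%:E) +
     c0%:E * (\int[P]_(w in @obsX R d @^-1` D) (1 - u w)%:E))%E.
  move=> mu u0 u1.
  have mu1 : measurable_fun (@obsX R d @^-1` D) (fun w => (u w)%:E).
    by apply/measurable_EFinP; exact: measurable_funTS.
  have mu2 : measurable_fun (@obsX R d @^-1` D) (fun w => (1 - u w)%:E).
    by apply/measurable_EFinP; apply: measurable_funTS; meas.
  rewrite -[X in (X + _)%E]ge0_integralZl//; last by move=> w _; rewrite lee_fin.
  rewrite -[X in (_ + X)%E]ge0_integralZl//; last by move=> w _; rewrite lee_fin.
  rewrite -ge0_integralD//.
  - by apply: eq_integral => w _; rewrite EFinD !EFinM muleC [X in (_ + X)%E]muleC.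
  - by move=> w _; rewrite mule_ge0 ?lee_fin.
  - by apply/measurable_EFinP; apply: measurable_funTS; meas.
  - by move=> w _; rewrite mule_ge0 ?lee_fin.
  - by apply/measurable_EFinP; apply: measurable_funTS; meas.
rewrite split_int// -intZ -intNZ -split_int//.
- by apply: eq_integral => w _; case: (obsZ w);
    rewrite ?subrr ?subr0 ?mul0r ?mul1r ?addr0 ?add0r.
- by meas.
- by move=> w; case: (obsZ w); rewrite ?subrr ?subr0.
Qed.

Variable lam : probability R R.

(** The weights may depend on the rank because it is independent of [(X, Z)]: at each fixed rank
    this is the previous identity. Reducing first to indicators makes Tonelli available even for
    signed [h]. *)
Lemma integral_propensity_prod (g1 g0 : R -> R) (h : d.-tuple R * R -> \bar R) :
  measurable_fun setT g1 -> measurable_fun setT g0 ->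
  (forall v, 0 <= g1 v) -> (forall v, 0 <= g0 v) -> measurable_fun setT h ->
  (\int[P \x lam]_p (h (obsX p.1, p.2) * (if obsZ p.1 then g1 p.2 else g0 p.2)%:E) =
   \int[P \x lam]_p (h (obsX p.1, p.2) *
     (e (obsX p.1) * g1 p.2 + (1 - e (obsX p.1)) * g0 p.2)%:E))%E.
Proof.
move=> mg1 mg0 g10 g00.
have mX : measurable_fun setT (fun p : Obs R d * R => obsX p.1).
  exact: (measurableT_comp (@measurable_obsX R d) measurable_fst).
have mZ : measurable_fun setT (fun p : Obs R d * R => obsZ p.1).
  exact: (measurableT_comp (@measurable_obsZ R d) measurable_fst).
have mv : measurable_fun setT (fun p : Obs R d * R => p.2) by exact: measurable_snd.
have mXv : measurable_fun setT (fun p : Obs R d * R => (obsX p.1, p.2)).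
  exact: measurable_fun_pair.
have meX : measurable_fun setT (fun p : Obs R d * R => e (obsX p.1)).
  exact: (measurableT_comp mEc mX).
have mg1v : measurable_fun setT (fun p : Obs R d * R => g1 p.2).
  exact: (measurableT_comp mg1 mv).
have mg0v : measurable_fun setT (fun p : Obs R d * R => g0 p.2).
  exact: (measurableT_comp mg0 mv).
have mf1 : measurable_fun setT (fun p : Obs R d * R => if obsZ p.1 then g1 p.2 else g0 p.2).
  by meas.
have mf2 : measurable_fun setT (fun p : Obs R d * R =>
    e (obsX p.1) * g1 p.2 + (1 - e (obsX p.1)) * g0 p.2) by meas.
have f1_ge0 (p : Obs R d * R) : 0 <= if obsZ p.1 then g1 p.2 else g0 p.2.
  by case: ifP.
have f2_ge0 (p : Obs R d * R) : 0 <= e (obsX p.1) * g1 p.2 + (1 - e (obsX p.1)) * g0 p.2.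
  by rewrite addr_ge0// mulr_ge0.
apply: integral_transfer => // D mD.
have mD1 : measurable_fun setT (\1_D : _ -> R) by exact: measurable_indic.
have m1D : measurable_fun setT (fun p : Obs R d * R => \1_D (obsX p.1, p.2) : R).
  exact: (measurableT_comp mD1 mXv).
have mk (f : Obs R d * R -> R) :
    (\int[P \x lam]_(p in (fun p => (obsX p.1, p.2)) @^-1` D) (f p)%:E =
     \int[P \x lam]_p (\1_D (obsX p.1, p.2) * f p)%:E)%E.
  rewrite integral_mkcond; apply: eq_integral => p _; rewrite patchE indicE.
  rewrite -[p \in _]/((obsX p.1, p.2) \in D).
  by case: ifP; rewrite ?mul1r ?mul0r.
rewrite !mk [LHS](@fubini_tonelli2 _ _ _ _ _ P lam)/=; last 2 first.
- by meas.
- by move=> p; rewrite lee_fin mulr_ge0.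
rewrite [RHS](@fubini_tonelli2 _ _ _ _ _ P lam)/=; last 2 first.
- by meas.
- by move=> p; rewrite lee_fin mulr_ge0.
apply: eq_integral => v _ /=; rewrite /fubini_G/=.
under eq_integral do rewrite EFinM; under [RHS]eq_integral do rewrite EFinM.
apply: (integral_propensity (h := fun x => (\1_D (x, v))%:E)) => //.
apply/measurable_EFinP.
exact: (measurableT_comp mD1 (@measurable_pair2 _ _ _ _ v)).
Qed.

End propensity.

(** * Tilts *)

Section odds.
Context {R : realType}.
Implicit Types (e u r Lam : R).

(** The odds of [e / (e + (1 - e) * r)] relative to those of [e] are [r^-1], and [[Lam^-1, Lam]] is
    stable under inversion. *)
Lemma msm_bound_tilt Lam e r : 0 < Lam -> 0 < e < 1 -> Lam^-1 <= r <= Lam ->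
  msm_bound Lam (e / (e + (1 - e) * r)) e.
Proof.
move=> L0 /andP[e0 e1] /andP[r1 r2].
have r0 : 0 < r by apply: lt_le_trans r1; rewrite invr_gt0.
have e1' : 0 < 1 - e by rewrite subr_gt0.
have w0 : 0 < e + (1 - e) * r by rewrite addr_gt0// mulr_gt0.
rewrite /msm_bound (_ : odds _ / odds e = r^-1); last first.
  rewrite /odds.
  have -> : 1 - e / (e + (1 - e) * r) = (1 - e) * r / (e + (1 - e) * r).
    by field; rewrite gt_eqF.
  by field; rewrite !gt_eqF.
by rewrite lef_pV2 ?posrE// r2/= -[leRHS]invrK lef_pV2 ?posrE// invr_gt0.
Qed.

(** Here [r] is the inverse of the odds ratio. The degenerate values 0 and 1 of [u] are excluded by
    the bound itself, since the convention for division by zero gives them odds 0. *)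
Lemma msm_boundP Lam e u : 0 < Lam -> 0 < e < 1 -> msm_bound Lam u e ->
  exists2 r, Lam^-1 <= r <= Lam & u^-1 = (e + (1 - e) * r) / e.
Proof.
move=> L0 /andP[e0 e1]; rewrite /msm_bound; set k := odds u / odds e => /andP[k1 k2].
have e1' : 0 < 1 - e by rewrite subr_gt0.
have k0 : 0 < k by apply: lt_le_trans k1; rewrite invr_gt0.
have u0 : u != 0.
  by apply/eqP => u0; move: k0; rewrite /k /odds u0 !mul0r ltxx.
have u1 : 1 - u != 0.
  by apply/eqP => u1; move: k0; rewrite /k /odds u1 invr0 mulr0 mul0r ltxx.
exists k^-1.
  by rewrite lef_pV2 ?posrE// k2/= -[leRHS]invrK lef_pV2 ?posrE// invr_gt0.
rewrite /k /odds; field.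
by rewrite u0 u1 !gt_eqF.
Qed.

End odds.

Section tilt.
Context {R : realType} {d : nat} (P : probability (Obs R d) R)
  (e : d.-tuple R -> R) (F : R -> d.-tuple R -> bool -> R) (Lam : R).
Hypothesis he : is_propensity P e.
Hypothesis e01 : forall x, 0 < e x < 1.
Hypothesis cdfF : is_cond_cdf P F.
Hypothesis Lam1 : 1 <= Lam.
Hypothesis iYe : P.-integrable setT (fun w => (obsY w * (obsZ w)%:R / e (obsX w))%:E).
Variable lam : probability R R.
Hypothesis lamE : forall c : R, 0 <= c <= 1 -> lam [set v | v <= c] = c%:E.
Hypothesis lam01 : {ae lam, forall v, 0 < v < 1}.

Let Lam0 : 0 < Lam. Proof. exact: lt_le_trans Lam1. Qed.
Let e_gt0 x : 0 < e x. Proof. by have /andP[] := e01 x. Qed.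
Let e_ge0 x : 0 <= e x. Proof. exact: ltW. Qed.
Let e_le1 x : 0 <= 1 - e x.
Proof. by rewrite subr_ge0; have /andP[_ /ltW] := e01 x. Qed.

(* [r] is the odds ratio of [e] to [Ebar]; mean [1] makes [E[Z / Ebar | X] = 1]. *)
Definition is_tilt (r : R -> R) :=
  [/\ measurable_fun setT r, forall v, Lam^-1 <= r v <= Lam &
      (\int[lam]_v (r v)%:E = 1)%E].

Lemma tilt_ge0 r v : is_tilt r -> 0 <= r v.
Proof.
by move=> [_ /(_ v)/andP[+ _] _]; apply: le_trans; rewrite invr_ge0 ltW.
Qed.

Lemma is_tilt_conv r1 r2 s : 0 <= s <= 1 -> is_tilt r1 -> is_tilt r2 ->
  is_tilt (fun v => s * r1 v + (1 - s) * r2 v).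
Proof.
move=> /andP[s0 s1] t1 t2; have [mr1 b1 i1] := t1; have [mr2 b2 i2] := t2.
have s1' : 0 <= 1 - s by rewrite subr_ge0.
split; first by meas.
- move=> v; have /andP[] := b1 v; have /andP[] := b2 v; move=> ? ? ? ?.
  by apply/andP; split; nra.
- under eq_integral do rewrite EFinD !EFinM.
  rewrite ge0_integralD//.
  + rewrite !ge0_integralZl//; try by [meas|move=> v _; rewrite lee_fin tilt_ge0].
    by rewrite i1 i2 !mule1 -EFinD addrCA subrr addr0.
  + by move=> v _; rewrite mule_ge0// lee_fin// tilt_ge0.
  + by apply/measurable_EFinP; meas.
  + by move=> v _; rewrite mule_ge0// lee_fin// tilt_ge0.
  + by apply/measurable_EFinP; meas.
Qed.

(* [e / Ebar] for the [Ebar] of tilt [r] *)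
Definition tiltw (r : R -> R) (p : Obs R d * R) : R :=
  e (obsX p.1) + (1 - e (obsX p.1)) * r p.2.

Lemma measurable_eXp : measurable_fun setT (fun p : Obs R d * R => e (obsX p.1)).
Proof.
have mXp := measurableT_comp (@measurable_obsX R d)
  (@measurable_fst _ _ (Obs R d) R).
exact: (measurableT_comp he.1 mXp).
Qed.

Lemma measurable_tiltw r : is_tilt r -> measurable_fun setT (tiltw r).
Proof.
move=> [mr _ _]; have := measurable_eXp; rewrite /tiltw => mE.
have mrp : measurable_fun setT (fun p : Obs R d * R => r p.2).
  exact: (measurableT_comp mr measurable_snd).
by meas.
Qed.

Lemma tiltw_gt0 r p : is_tilt r -> 0 < tiltw r p.
Proof.
by move=> tr; apply: ltr_pwDl => //; apply: mulr_ge0 => //; exact: tilt_ge0.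
Qed.

Lemma tiltw_leLam r p : is_tilt r -> tiltw r p <= Lam.
Proof.
move=> [_ /(_ p.2)/andP[_ rL] _]; rewrite /tiltw.
have := e_ge0 (obsX p.1); have := e_le1 (obsX p.1); move: Lam1 rL; move=> *; nra.
Qed.

Lemma integral_tilt_affine r a b : is_tilt r -> 0 <= a -> 0 <= b ->
  (\int[lam]_v (a + b * r v)%:E = (a + b)%:E)%E.
Proof.
move=> tr a0 b0; have [mr _ ir] := tr.
under eq_integral do rewrite EFinD.
rewrite ge0_integralD//.
- under [X in (_ + X)%E]eq_integral do rewrite EFinM.
  rewrite ge0_integralZl//; last 2 first.
  + exact/measurable_EFinP.
  + by move=> v _; rewrite lee_fin tilt_ge0.
  rewrite ir mule1 integral_cst// [X in (_ * X + _)%E](_ : _ = 1%E) ?mule1//.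
  exact: probability_setT.
- by move=> v _; rewrite lee_fin mulr_ge0// tilt_ge0.
- by apply/measurable_EFinP; meas.
Qed.

(** Given the observation, the rank averages [e + (1 - e) * r] to 1; this is where the mean of the
    tilt enters. *)
Lemma integral_tiltw_fst r (h : Obs R d -> \bar R) : is_tilt r ->
  measurable_fun setT h ->
  (\int[P \x lam]_p (h p.1 * (tiltw r p)%:E) = \int[P]_w h w)%E.
Proof.
move=> tr mh; under [RHS]eq_integral do rewrite -[h _]mule1.
have mt := measurable_tiltw tr.
apply: (integral_transfer (C2 := id) (f2 := fun=> 1)) => //.
- by move=> p; exact/ltW/tiltw_gt0.
move=> D mD; have mD1 : measurable_fun setT (\1_D : _ -> R) by exact: measurable_indic.
have m1D : measurable_fun setT (fun p : Obs R d * R => \1_D p.1 : R).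
  exact: (measurableT_comp mD1 measurable_fst).
rewrite integral_cst// mul1e integral_mkcond.
transitivity (\int[P \x lam]_p (\1_D p.1 * tiltw r p)%:E)%E.
  apply: eq_integral => p _; rewrite patchE indicE.
  rewrite -[p \in _]/(p.1 \in D).
  by case: ifP; rewrite ?mul1r ?mul0r.
rewrite fubini_tonelli1//=; last 2 first.
- by meas.
- by move=> p; rewrite lee_fin mulr_ge0//; exact/ltW/tiltw_gt0.
rewrite /fubini_F -[X in P X]setIT -integral_indic//; apply: eq_integral => w _.
rewrite /tiltw/=; under eq_integral do rewrite mulrDr mulrA.
by rewrite integral_tilt_affine ?mulr_ge0// -mulrDr addrCA subrr addr0 mulr1.
Qed.

(** The latent [Y(1)], defined for untreated units as well. *)
Definition treated (p : Obs R d * R) : R := qtf F p.2 (obsX p.1) true.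

Lemma measurable_treated : measurable_fun setT treated.
Proof.
have mXp := measurableT_comp (@measurable_obsX R d)
  (@measurable_fst _ _ (Obs R d) R).
have mXv : measurable_fun setT (fun p : Obs R d * R => (obsX p.1, p.2)).
  by apply: measurable_fun_pair => //; exact: measurable_snd.
exact: (measurableT_comp (measurable_qtf cdfF true) mXv).
Qed.

Lemma integral_resample (h : Obs R d -> \bar R) : measurable_fun setT h ->
  (\int[P]_w h w = \int[P \x lam]_p h (resample F p))%E.
Proof.
apply: integral_law; first exact: measurable_resample cdfF.
exact: resample_law.
Qed.

(** Given [X] and the rank, [Z] has mean [e(X)], so the factor [Z / e] averages to 1; the tilted
    weight depends on [X] and the rank only and goes along with [h]. *)
Lemma integral_tilt_treated r (h : d.-tuple R * R -> R) : is_tilt r ->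
  measurable_fun setT h ->
  (\int[P \x lam]_p (h (obsX p.1, p.2) * (obsZ p.1)%:R * tiltw r p / e (obsX p.1))%:E =
   \int[P \x lam]_p (h (obsX p.1, p.2) * tiltw r p)%:E)%E.
Proof.
move=> tr mh; have [mr _ _] := tr.
have mex : measurable_fun setT (fun p : d.-tuple R * R => e p.1).
  exact: (measurableT_comp he.1 measurable_fst).
have mrx : measurable_fun setT (fun p : d.-tuple R * R => r p.2).
  exact: (measurableT_comp mr measurable_snd).
pose g (p : d.-tuple R * R) := (h p * (e p.1 + (1 - e p.1) * r p.2) / e p.1)%:E.
have mg : measurable_fun setT g by rewrite /g; meas.
have m1 : measurable_fun setT (fun _ : R => 1 : R) by [].
have m0 : measurable_fun setT (fun _ : R => 0 : R) by [].
have := integral_propensity_prod he e01 lam m1 m0 (fun=> ler01) (fun=> lexx 0) mg.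
move=> E; etransitivity; [etransitivity; [|exact: E]|].
- apply: eq_integral => p _; rewrite /g/= -EFinM /tiltw; congr _%:E.
  by case: (obsZ p.1); rewrite ?mulr1 ?mulr0 ?mul0r// mulrA.
- apply: eq_integral => p _; rewrite /g/= -EFinM /tiltw; congr _%:E.
  by rewrite mulr1 mulr0 addr0 mulfVK// gt_eqF.
Qed.

Lemma is_tilt1 : is_tilt (fun=> 1).
Proof.
split => //; last by rewrite integral_cst// mul1e; exact: probability_setT.
by move=> _; rewrite Lam1 andbT invf_le1.
Qed.

(** With the constant tilt, the weight [Z / e] turns the first absolute moment of the latent [Y(1)]
    into that of [Y Z / e], finite by hypothesis. *)
Lemma integrable_treated : (P \x lam)%E.-integrable setT (EFin \o treated).
Proof.
have mt := measurable_treated.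
apply/integrableP; split; first exact/measurable_EFinP.
have mabs : measurable_fun setT (fun p : d.-tuple R * R => `|qtf F p.2 p.1 true|).
  exact: (measurableT_comp (@normr_measurable R setT) (measurable_qtf cdfF true)).
have := integral_tilt_treated is_tilt1 mabs.
have tw1 p : tiltw (fun=> 1) p = 1 by rewrite /tiltw mulr1 addrCA subrr addr0.
under [RHS]eq_integral do rewrite tw1 mulr1.
move=> E; rewrite [X in (X < _)%E](_ : _ =
  \int[P \x lam]_p (`|treated p|)%:E)%E//.
rewrite /treated -E; move/integrableP : iYe => [mYe].
rewrite integral_resample; last first.
  by apply: measurableT_comp => //.
apply: le_lt_trans; rewrite le_eqVlt; apply/orP; left; apply/eqP.
apply: eq_integral => p _; rewrite tw1/=.
rewrite !normrM normfV (gtr0_norm (e_gt0 _)) mulr1.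
rewrite /resample /obsX /obsY/=.
by case: (obsZ p.1); rewrite ?normr1 ?normr0 ?mulr0 ?mul0r ?mulr1.
Qed.

Lemma integrable_treated_tiltw r : is_tilt r ->
  (P \x lam)%E.-integrable setT (fun p => (treated p * tiltw r p)%:E).
Proof.
move=> tr; have mt := measurable_treated; have mw := measurable_tiltw tr.
apply: (@le_integrable _ _ _ _ setT measurableT _ (fun p => Lam%:E * (treated p)%:E)%E).
- by meas.
- move=> p _; rewrite -EFinM /= lee_fin !normrM mulrC ler_wpM2r//.
  rewrite (gtr0_norm (tiltw_gt0 _ tr)) gtr0_norm//; exact: tiltw_leLam.
- exact: integrableZl integrable_treated.
Qed.

(** Both the objective at the weight of tilt [r] and the mean of [Y(1)] under the full-data law
    built from [r]. *)
Definition tilt_val r : \bar R := (\int[P \x lam]_p (treated p * tiltw r p)%:E)%E.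

Lemma tilt_val_fin_num r : is_tilt r -> tilt_val r \is a fin_num.
Proof. by move=> tr; apply: integrable_fin_num => //; exact: integrable_treated_tiltw. Qed.

Lemma tilt_val_conv r1 r2 s : is_tilt r1 -> is_tilt r2 ->
  tilt_val (fun v => s * r1 v + (1 - s) * r2 v) = (s%:E * tilt_val r1 + (1 - s)%:E * tilt_val r2)%E.
Proof.
move=> t1 t2; have i1 := integrable_treated_tiltw t1; have i2 := integrable_treated_tiltw t2.
rewrite /tilt_val -!integralZl// -integralD//; [|exact: integrableZl|exact: integrableZl].
by apply: eq_integral => p _; rewrite -!EFinM -EFinD /tiltw; congr _%:E; ring.
Qed.

(** The witness is the joint law of the resampled observation and of [e / tiltw]. Its constraint
    holds for every measurable function of [X], as an equality of extended integrals, so the same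
    law is feasible for both problems. *)
Lemma tilt_Einf r : is_tilt r -> exists mu : probability (Obs R d * R)%type R,
  [/\ Einf P e Lam mu,
      forall q, measurable_fun setT q -> qconstr P mu q &
      ipw mu (@obsY R d) = tilt_val r].
Proof.
move=> tr; have mw := measurable_tiltw tr; have mE := measurable_eXp.
pose C (p : Obs R d * R) := (resample F p, e (obsX p.1) / tiltw r p).
have mC : measurable_fun setT C.
  by apply: measurable_fun_pair; [exact: measurable_resample cdfF|meas].
have m1 : measurable_fun setT (fun _ : Obs R d * R => 1 : R) by [].
have [|mu [muE muI]] := probability_with_density mC m1 (fun=> ler01) (m := (P \x lam)%E).
  by rewrite integral_cst// mul1e; exact: probability_setT.
have {}muE A : measurable A -> mu A = (P \x lam)%E (C @^-1` A).
  move=> mA; rewrite muE// integral_cst ?mul1e//; exact: measurable_preimageT.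
have {}muI (h : Obs R d * R -> \bar R) : measurable_fun setT h ->
    (\int[mu]_w h w = \int[P \x lam]_p h (C p))%E.
  by move=> mh; rewrite muI//; apply: eq_integral => p _; rewrite mule1.
have mX2 : measurable_fun setT (fun w : Obs R d * R => obsX w.1).
  exact: (measurableT_comp (@measurable_obsX R d) measurable_fst).
have mZ2 : measurable_fun setT (fun w : Obs R d * R => obsZ w.1).
  exact: (measurableT_comp (@measurable_obsZ R d) measurable_fst).
have mY2 : measurable_fun setT (fun w : Obs R d * R => obsY w.1).
  exact: (measurableT_comp (@measurable_obsY R d) measurable_fst).
have m2 : measurable_fun setT (fun w : Obs R d * R => w.2) by exact: measurable_snd.
exists mu; split.
- split.
    move=> A mA; rewrite muE; last by exact: measurable_preimageT.
    by rewrite (resample_law cdfF lamE lam01).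
  have mB : measurable [set w : Obs R d * R | Lam^-1 <= odds w.2 / odds (e (obsX w.1)) <= Lam].
    apply: measurable_is_true; rewrite /odds.
    apply: measurable_and; apply: measurable_fun_ler => //; by meas.
  exists (~` [set w : Obs R d * R | Lam^-1 <= odds w.2 / odds (e (obsX w.1)) <= Lam]); split => //.
  + exact: measurableC.
  + rewrite muE; last exact: measurableC.
    rewrite (_ : C @^-1` _ = set0) ?measure0//; apply/seteqP; split => // p /= h.
    by apply: h; apply: msm_bound_tilt => //; have [] := tr.
- move=> q mq; rewrite /qconstr /ipw.
  have mqX2 : measurable_fun setT (fun w : Obs R d * R => q (obsX w.1)).
    exact: (measurableT_comp mq mX2).
  rewrite muI; last by meas.
  have mqx : measurable_fun setT (fun p : d.-tuple R * R => q p.1).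
    exact: (measurableT_comp mq measurable_fst).
  have mqX : measurable_fun setT (fun w : Obs R d => (q (obsX w))%:E).
    apply/measurable_EFinP.
    exact: (measurableT_comp mq (@measurable_obsX R d)).
  rewrite -(integral_tiltw_fst tr mqX).
  under [RHS]eq_integral do rewrite -EFinM.
  rewrite -(integral_tilt_treated tr mqx).
  by apply: eq_integral => p _; rewrite /C/= invf_div mulrA.
- rewrite /ipw muI; last by meas.
  rewrite /tilt_val -(integral_tilt_treated tr (measurable_qtf cdfF true)).
  apply: eq_integral => p _; rewrite /C /resample /obsY /obsX /obsZ/= invf_div mulrA.
  (* The resampled outcome is [treated] only for treated units; the factor [obsZ] removes the
     others. *)
  by case: (p.1.2); rewrite ?mulr1 ?mulr0.
Qed.

End tilt.

(** * Optimality *)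

Lemma measurable_abseEFin {R : realType} {d : measure_display}
    {T : measurableType d} (f : T -> R) :
  measurable_fun setT f -> measurable_fun setT (fun x => `|(f x)%:E|%E).
Proof.
move=> mf; apply/measurable_EFinP.
exact: (measurableT_comp (@normr_measurable R setT) mf).
Qed.

Section optimality.
Context {R : realType} {d : nat} (P : probability (Obs R d) R)
  (e : d.-tuple R -> R) (F : R -> d.-tuple R -> bool -> R) (Lam : R).
Hypothesis he : is_propensity P e.
Hypothesis e01 : forall x, 0 < e x < 1.
Hypothesis cdfF : is_cond_cdf P F.
Hypothesis Lam1 : 1 <= Lam.
Hypothesis iYe : P.-integrable setT (fun w => (obsY w * (obsZ w)%:R / e (obsX w))%:E).
Variable lam : probability R R.
Hypothesis lamE : forall c : R, 0 <= c <= 1 -> lam [set v | v <= c] = c%:E.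
Hypothesis lam01 : {ae lam, forall v, 0 < v < 1}.
Variable t : R.
Hypothesis t01 : 0 < t < 1.

Let Lam0 : 0 < Lam. Proof. exact: lt_le_trans Lam1. Qed.
Let e_gt0 x : 0 < e x. Proof. by have /andP[] := e01 x. Qed.
Let e_ge0 x : 0 <= e x. Proof. exact: ltW. Qed.
Let e_le1 x : 0 <= 1 - e x.
Proof. by rewrite subr_ge0; have /andP[_ /ltW] := e01 x. Qed.
Let q x := Qt F t x true.
Let mX := @measurable_obsX R d.
Let mY := @measurable_obsY R d.
Let mZ := @measurable_obsZ R d.
Let meX : measurable_fun setT (fun w : Obs R d => e (obsX w)).
Proof. exact: (measurableT_comp he.1 mX). Qed.

Lemma measurable_Qt : measurable_fun setT (fun x => Qt F t x true).
Proof.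
have := measurableT_comp (measurable_qtf cdfF true) (@measurable_pair2 _ _ (d.-tuple R) R t).
by apply: eq_measurable_fun => x _ /=; rewrite /qtf t01.
Qed.

Let mqX : measurable_fun setT (fun w : Obs R d => q (obsX w)).
Proof. exact: (measurableT_comp measurable_Qt mX). Qed.

Lemma ae_snd : {ae (P \x lam)%E, forall p, 0 < p.2 < 1}.
Proof.
have [N [mN N0 sN]] := lam01.
exists (setT `*` N); split => //.
- exact: measurableX.
- transitivity (P setT * lam N)%E; first exact: product_measure1E.
  by rewrite N0 mule0.
- by move=> p /= h; split => //; apply: sN.
Qed.

Lemma lam_gt c : 0 <= c <= 1 -> lam [set v | c < v] = (1 - c)%:E.
Proof.
move=> c01; have mc : measurable [set v : R | v <= c].
  by apply: measurable_is_true; exact: measurable_fun_ler.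
rewrite (_ : [set v | c < v] = ~` [set v | v <= c]); last first.
  by apply/seteqP; split => v /=; rewrite ltNge => /negP.
by rewrite probability_setC// lamE.
Qed.

(** If [q >= 0], ranks above [t] give [Y(1) >= q]; if [q < 0], ranks up to [t] give [Y(1) <= q].
    Either way the absolute value of [Y(1)] is at least that of [q] on a set of ranks of mass at
    least [min(t, 1 - t)], so integrability passes from [treated] to the quantile. *)
Lemma integrable_Qt : P.-integrable setT (fun w => (Qt F t (obsX w) true)%:E).
Proof.
have /andP[t0 t1] := t01.
pose c := Num.min t (1 - t).
have c0 : 0 < c by rewrite lt_min t0 subr_gt0.
suff : P.-integrable setT (fun w => (c * q (obsX w))%:E).
  move=> ic; have := integrableZl measurableT c^-1 ic.
  apply: eq_integrable => // w _.
  by rewrite -EFinM mulKf// gt_eqF.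
apply/integrableP; split; first by meas.
have mp : measurable_fun setT (fun p : Obs R d * R => q (obsX p.1)).
  exact: (measurableT_comp mqX measurable_fst).
have mv : measurable_fun setT (fun p : Obs R d * R => p.2) by exact: measurable_snd.
have mnp : measurable_fun setT (fun p : Obs R d * R => `|q (obsX p.1)|).
  exact: (measurableT_comp (@normr_measurable R setT) mp).
have mt := measurable_treated cdfF.
(* The indicator of the ranks at which [treated] lies at least as far from 0 as [q]. *)
pose k (p : Obs R d * R) : R := if 0 <= q (obsX p.1) then (t < p.2)%R%:R else (p.2 <= t)%R%:R.
have k0 p : 0 <= k p by rewrite /k; case: ifP.
have mk : measurable_fun setT k.
  rewrite /k; apply: measurable_fun_ifT.
  - by apply: measurable_fun_ler.
  - by apply: measurable_boolR; exact: measurable_fun_ltr.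
  - by apply: measurable_boolR; exact: measurable_fun_ler.
apply: (@le_lt_trans _ _ (\int[P \x lam]_p (`|q (obsX p.1)| * k p)%:E)%E); last first.
  have /integrableP[_] := integrable_treated he e01 cdfF Lam1 iYe lamE lam01.
  apply: le_lt_trans; apply: ae_ge0_le_integral => //.
  - by move=> p _; rewrite lee_fin mulr_ge0.
  - by meas.
  - exact: measurable_abseEFin.
  apply: filterS ae_snd => p p01 _; rewrite /= lee_fin /treated /qtf p01 /k.
  have /andP[p0 p1] := p01.
  case: ifPn => [q0|]; last rewrite -ltNge => q0.
    case: (ltP t p.2) => tp; last by rewrite mulr0.
    rewrite mulr1 (ger0_norm q0).
    by apply: le_trans (ler_norm _); apply: (le_Qt cdfF) => //; exact: ltW.
  case: (leP p.2 t) => pt; last by rewrite mulr0.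
  rewrite mulr1 (ltr0_norm q0) -normrN.
  by apply: le_trans (ler_norm _); rewrite lerN2; exact: (le_Qt cdfF).
rewrite fubini_tonelli1//=; last 2 first.
- by meas.
- by move=> p; rewrite lee_fin mulr_ge0.
apply: ge0_le_integral => //.
- by apply: measurable_abseEFin; meas.
- apply: measurable_fun_fubini_tonelli_F; first by meas.
  by move=> p; rewrite lee_fin mulr_ge0.
move=> w _; rewrite /fubini_F /k/= normrM gtr0_norm// mulrC EFinM.
have t01' : 0 <= t <= 1 by rewrite !ltW.
have indE (b : R -> bool) : measurable_fun setT b ->
    (\int[lam]_v (`|q (obsX w)| * (b v)%:R)%:E =
     `|q (obsX w)|%:E * lam [set v | b v])%E.
  move=> mb; under eq_integral do rewrite EFinM.
  rewrite ge0_integralZl//; last first.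
    by apply/measurable_EFinP; exact: measurable_boolR.
  by rewrite integral_boolR// setIT.
case: (leP 0 (q (obsX w))) => q0 /=.
- rewrite indE; last exact: measurable_fun_ltr.
  by rewrite lam_gt// lee_wpmul2l// lee_fin// ge_min lexx orbT.
- rewrite indE; last exact: measurable_fun_ler.
  by rewrite lamE// lee_wpmul2l// lee_fin// ge_min lexx.
Qed.

Lemma integrable_Qt_ipw :
  P.-integrable setT (fun w => (q (obsX w) * (obsZ w)%:R / e (obsX w))%:E).
Proof.
have /integrableP[mq iq] := integrable_Qt.
apply/integrableP; split; first by meas.
have mqe : measurable_fun setT (fun x => (`|q x| / e x)%:E).
  have m1 := measurableT_comp (@normr_measurable R setT) measurable_Qt.
  have m2 := he.1.
  by meas.
have := integral_propensity he e01 ler01 (lexx 0) mqe => E.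
rewrite (_ : (\int[P]_w _)%E = \int[P]_w (`|q (obsX w)|)%:E)%E//.
transitivity (\int[P]_w ((`|q (obsX w)| / e (obsX w))%:E * (if obsZ w then 1 else 0)%:E))%E.
  apply: eq_integral => w _ /=; rewrite !normrM normfV (gtr0_norm (e_gt0 _)).
  by case: (obsZ w); rewrite ?normr1 ?normr0 ?mulr0 ?mul0r ?mulr1 ?mule1 ?mule0.
rewrite E; apply: eq_integral => w _.
by rewrite mulr1 mulr0 addr0 -EFinM mulfVK// gt_eqF.
Qed.

(* Makes the almost sure odds-ratio bound hold everywhere. *)
Definition clamp (w : Obs R d * R) : R :=
  if Lam^-1 <= odds w.2 / odds (e (obsX w.1)) <= Lam then w.2 else e (obsX w.1).

Lemma clampP w : exists2 r, Lam^-1 <= r <= Lam &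
  (clamp w)^-1 = (e (obsX w.1) + (1 - e (obsX w.1)) * r) / e (obsX w.1).
Proof.
rewrite /clamp; case: ifPn => h; first exact: msm_boundP.
(* The fallback value [e] is the weight of the constant tilt 1. *)
exists 1; first by rewrite Lam1 andbT invf_le1.
by rewrite mulr1 addrCA subrr addr0 mul1r.
Qed.

Let mX2 : measurable_fun setT (fun w : Obs R d * R => obsX w.1).
Proof. exact: (measurableT_comp mX measurable_fst). Qed.
Let mZ2 : measurable_fun setT (fun w : Obs R d * R => obsZ w.1).
Proof. exact: (measurableT_comp mZ measurable_fst). Qed.
Let meX2 : measurable_fun setT (fun w : Obs R d * R => e (obsX w.1)).
Proof. exact: (measurableT_comp he.1 mX2). Qed.
Let m2 : measurable_fun setT (fun w : Obs R d * R => w.2).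
Proof. exact: measurable_snd. Qed.

Lemma measurable_clamp : measurable_fun setT clamp.
Proof.
rewrite /clamp /odds; apply: measurable_fun_ifT => //.
by apply: measurable_and; apply: measurable_fun_ler => //; meas.
Qed.

Variable mu : probability (Obs R d * R)%type R.
Hypothesis muE : Einf P e Lam mu.

Lemma ipw_clamp (g : Obs R d -> R) : measurable_fun setT g ->
  ipw mu g = (\int[mu]_w (g w.1 * (obsZ w.1)%:R / clamp w)%:E)%E.
Proof.
move=> mg; have mg2 : measurable_fun setT (fun w : Obs R d * R => g w.1).
  exact: (measurableT_comp mg measurable_fst).
have mc := measurable_clamp.
apply: ae_eq_integral => //; [by meas|by meas|].
by apply: filterS muE.2 => w hw _; rewrite /clamp ifT.
Qed.

Lemma integral_Einf_fst (h : Obs R d -> \bar R) : measurable_fun setT h ->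
  (\int[mu]_w h w.1 = \int[P]_w h w)%E.
Proof.
move=> mh; apply/esym/integral_law => // D mD; exact: esym (muE.1 D mD).
Qed.

Lemma integrable_Einf_fst (h : Obs R d -> R) : P.-integrable setT (EFin \o h) ->
  mu.-integrable setT (fun w => (h w.1)%:E).
Proof.
move=> /integrableP[mh ih]; apply/integrableP; split.
  exact: (measurableT_comp mh measurable_fst).
rewrite (integral_Einf_fst (h := fun w => `|(h w)%:E|%E))//.
by apply: measurable_abseEFin; exact/measurable_EFinP.
Qed.

(** Since [e + (1 - e) * r <= Lam], the inverse weight is at most [Lam / e]. *)
Lemma integrable_clamp (g : Obs R d -> R) : measurable_fun setT g ->
  P.-integrable setT (fun w => (g w * (obsZ w)%:R / e (obsX w))%:E) ->
  mu.-integrable setT (fun w => (g w.1 * (obsZ w.1)%:R / clamp w)%:E).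
Proof.
move=> mg ig; have mg2 : measurable_fun setT (fun w : Obs R d * R => g w.1).
  exact: (measurableT_comp mg measurable_fst).
have mc := measurable_clamp.
have := integrableZl measurableT Lam (integrable_Einf_fst ig).
apply: le_integrable => //; first by meas.
move=> w _; have [r /andP[r0 rL] ->] := clampP w.
rewrite -EFinM /= lee_fin [leRHS]normrM gtr0_norm// !normrM [X in _ <= X]mulrC -mulrA.
rewrite mulrA -[leRHS]mulrA ler_wpM2l ?mulr_ge0// [leRHS]mulrC ler_wpM2r//.
have r0' : 0 <= r by apply: le_trans r0; rewrite invr_ge0 ltW.
rewrite ger0_norm ?addr_ge0 ?mulr_ge0//.
by have := e_ge0 (obsX w.1); have := e_le1 (obsX w.1); move: Lam1 rL => *; nra.
Qed.

(* [s] is [1] for the maximum and [-1] for the minimum; [a] and [b] are the values of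
   the optimal tilt above and below the rank [t] of the quantile. *)
Variables (s a b : R).
Hypothesis s1 : s = 1 \/ s = -1.
Hypothesis ab : forall r, Lam^-1 <= r <= Lam -> s * r <= s * a /\ s * b <= s * r.
Hypothesis aL : Lam^-1 <= a <= Lam.
Hypothesis bL : Lam^-1 <= b <= Lam.

(** The signed integrand of objective minus constraint, where [1 / Ebar] is written through its tilt
    value [r]. It is affine in [r]. *)
Definition ipw_term (r : R) (w : Obs R d) : R :=
  s * (obsY w - q (obsX w)) * (obsZ w)%:R *
    (e (obsX w) + (1 - e (obsX w)) * r) / e (obsX w).

Lemma measurable_ipw_term r : measurable_fun setT (ipw_term r).
Proof. by rewrite /ipw_term; meas. Qed.

Lemma ipw_term_le r1 r2 w : 0 <= (s * r2 - s * r1) * (obsY w - q (obsX w)) ->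
  ipw_term r1 w <= ipw_term r2 w.
Proof.
move=> h; rewrite -subr_ge0 (_ : _ - _ = (s * r2 - s * r1) * (obsY w - q (obsX w)) *
    ((obsZ w)%:R * (1 - e (obsX w)) / e (obsX w))); last first.
  by rewrite /ipw_term; ring.
by rewrite mulr_ge0// !mulr_ge0 ?invr_ge0.
Qed.

(** The slope in [r] has the sign of [s * (Y - q)] or vanishes, so [a] is best when [Y >= q] and [b]
    otherwise. The maximum is a bound free of [r]. *)
Lemma ipw_term_max r w : Lam^-1 <= r <= Lam ->
  ipw_term r w <= Num.max (ipw_term a w) (ipw_term b w).
Proof.
move=> /ab[ra br]; rewrite le_max; case: (leP (q (obsX w)) (obsY w)) => h.
- by rewrite ipw_term_le// mulr_ge0// subr_ge0.
- by rewrite [X in _ || X]ipw_term_le ?orbT// mulr_le0// subr_le0// ltW.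
Qed.

Lemma integrable_ipw_term r : Lam^-1 <= r <= Lam ->
  P.-integrable setT (EFin \o ipw_term r).
Proof.
move=> /andP[r0 rL].
have i1 := integrableB measurableT iYe integrable_Qt_ipw.
have mt := measurable_ipw_term r.
apply: le_integrable (integrableZl measurableT Lam i1) => //.
  exact/measurable_EFinP.
move=> w _; rewrite -EFinB -EFinM /= lee_fin /ipw_term.
rewrite (_ : _ * _ / _ = (e (obsX w) + (1 - e (obsX w)) * r) *
  (s * ((obsY w * (obsZ w)%:R / e (obsX w)) -
        (q (obsX w) * (obsZ w)%:R / e (obsX w))))); last by ring.
rewrite normrM [leRHS]normrM [`|Lam|]gtr0_norm//.
have r0' : 0 <= r by apply: le_trans r0; rewrite invr_ge0 ltW.
apply: ler_pM => //.
- rewrite ger0_norm ?addr_ge0 ?mulr_ge0//.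
  by have := e_ge0 (obsX w); have := e_le1 (obsX w); move: Lam1 rL => *; nra.
- by rewrite normrM; case: s1 => ->; rewrite ?normrN normr1 mul1r.
Qed.

Hypothesis tr : is_tilt Lam lam (fun v => if v <= t then b else a).

Lemma ipw_le : qconstr P mu (fun x => Qt F t x true) ->
  (s%:E * ipw mu (@obsY R d) <= s%:E * tilt_val P e F lam (fun v => if v <= t then b else a)%R)%E.
Proof.
move=> qc; set r := fun v => _.
have iY := integrable_clamp mY iYe.
have iq := integrable_clamp mqX integrable_Qt_ipw.
have fq : (\int[P]_w (q (obsX w))%:E)%E \is a fin_num.
  by apply: integrable_fin_num => //; exact: integrable_Qt.
have mc := measurable_clamp.
have mw := measurable_tiltw he tr.
(* [B] depends on the observation alone, so its mean is the same for every admissible [mu]; it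
   separates the competitor from the optimal tilt. *)
pose B w := Num.max (ipw_term a w) (ipw_term b w).
have mB : measurable_fun setT B by apply: measurable_maxr; exact: measurable_ipw_term.
have iB : P.-integrable setT (EFin \o B).
  have := integrableD measurableT (integrable_abse (integrable_ipw_term aL))
    (integrable_abse (integrable_ipw_term bL)).
  apply: le_integrable => //; first exact/measurable_EFinP.
  move=> w _; rewrite /= lee_fin [leRHS]ger0_norm ?addr_ge0// /B.
  by rewrite /Num.max; case: ifP => _; rewrite ?lerDl ?lerDr.
have lhs : (\int[mu]_w (s * (obsY w.1 - q (obsX w.1)) * (obsZ w.1)%:R / clamp w)%:E =
    s%:E * ipw mu (@obsY R d) - s%:E * \int[P]_w (q (obsX w))%:E)%E.
  rewrite -qc !ipw_clamp// -!integralZl// -integralB//; [|exact: integrableZl|exact: integrableZl].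
  by apply: eq_integral => w _; rewrite -!EFinM -EFinB; congr _%:E; ring.
have it := integrable_treated_tiltw he e01 cdfF Lam1 iYe lamE lam01 tr.
have mqw : measurable_fun setT (fun p : Obs R d * R => q (obsX p.1)).
  exact: (measurableT_comp mqX measurable_fst).
have iqt : (P \x lam)%E.-integrable setT (fun p => (q (obsX p.1) * tiltw e r p)%:E).
  apply/integrableP; split; first by meas.
  have /integrableP[_ ] := integrable_Qt.
  rewrite -(integral_tiltw_fst he e01 Lam1 tr); last first.
    exact: measurable_abseEFin.
  apply: le_lt_trans; rewrite le_eqVlt; apply/orP; left; apply/eqP.
  apply: eq_integral => p _ /=; rewrite normrM EFinM.
  by rewrite (gtr0_norm (tiltw_gt0 e01 Lam1 p tr)).
have rhs : (\int[P \x lam]_p (s * (treated F p - q (obsX p.1)) * tiltw e r p)%:E =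
    s%:E * tilt_val P e F lam r - s%:E * \int[P]_w (q (obsX w))%:E)%E.
  rewrite -(integral_tiltw_fst he e01 Lam1 tr); last exact/measurable_EFinP.
  under [X in (_ - _ * X)%E]eq_integral do rewrite -EFinM.
  rewrite /tilt_val -!integralZl//.
  rewrite -integralB//; [|exact: integrableZl|apply: integrableZl => //].
  by apply: eq_integral => p _; rewrite -!EFinM -EFinB; congr _%:E; ring.
(* The same term [s * E[q]] is subtracted on both sides, by the constraint on the left and by the
   mean of the tilt on the right; it cancels because it is finite. *)
suff : (\int[mu]_w (s * (obsY w.1 - q (obsX w.1)) * (obsZ w.1)%:R / clamp w)%:E <=
    \int[P \x lam]_p (s * (treated F p - q (obsX p.1)) * tiltw e r p)%:E)%E.
  by rewrite lhs rhs leeD2rE// fin_numN fin_numM.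
apply: (@le_trans _ _ (\int[mu]_w (B w.1)%:E)%E).
  apply: le_integral => //.
  - have := integrableB measurableT (integrableZl measurableT s iY) (integrableZl measurableT s iq).
    by apply: eq_integrable => // w _; rewrite -!EFinM -EFinB; congr _%:E; ring.
  - exact: integrable_Einf_fst.
  move=> w _; rewrite lee_fin; have [r' r'L ->] := clampP w.
  apply: le_trans (ipw_term_max w.1 r'L).
  by rewrite /ipw_term mulrA.
rewrite (integral_Einf_fst (h := EFin \o B)); last exact/measurable_EFinP.
rewrite (integral_resample cdfF lamE lam01); last exact/measurable_EFinP.
have mh : measurable_fun setT (fun p : d.-tuple R * R => s * (qtf F p.2 p.1 true - q p.1)).
  have m1 := measurable_qtf cdfF true.
  have m3 : measurable_fun setT (fun p : d.-tuple R * R => q p.1).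
    exact: (measurableT_comp measurable_Qt measurable_fst).
  by meas.
have mres := measurable_resample cdfF.
have mt := measurable_treated cdfF.
rewrite le_eqVlt; apply/orP; left; apply/eqP.
etransitivity; last exact: (integral_tilt_treated he e01 tr mh).
apply: ae_eq_integral => //.
- by apply/measurable_EFinP; exact: (measurableT_comp mB mres).
- have mt' : measurable_fun setT (fun p : Obs R d * R => qtf F p.2 (obsX p.1) true) := mt.
  by rewrite /=; meas.
apply: filterS ae_snd => p p01 _; congr _%:E.
(* The quantile is monotone in the rank, so a rank up to [t] gives [Y <= q] and a larger one
   [Y >= q]. When [Y = q] the slope vanishes and both choices agree, so ties at an atom are
   harmless. *)
have BE : B (resample F p) = ipw_term (r p.2) (resample F p).
  rewrite /B /r; case: (boolP (obsZ p.1)) => Zp; last first.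
    rewrite /ipw_term (_ : obsZ (resample F p) = false) ?mulr0 ?mul0r ?maxxx//.
    exact/negbTE.
  have YE : obsY (resample F p) = Qt F p.2 (obsX p.1) true.
    by rewrite /obsY /resample/= /qtf p01 Zp.
  have /andP[p0 p1] := p01; have /andP[t0 t1] := t01.
  have [_ ba] := ab aL.
  case: (leP p.2 t) => pt.
  - apply/max_idPr/ipw_term_le; rewrite YE mulr_le0// subr_le0//.
    exact: (le_Qt cdfF).
  - apply/max_idPl/ipw_term_le; rewrite YE mulr_ge0// subr_ge0//.
    by apply: (le_Qt cdfF) => //; exact: ltW.
rewrite BE /ipw_term /tiltw /resample /obsY /obsX /obsZ/=.
by case: (p.1.2); rewrite ?mulr0 ?mul0r.
Qed.

End optimality.

(** * From full-data laws to weights *)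

Section full_data.
Context {R : realType} {d k : nat}.

Lemma measurable_fX : measurable_fun setT (@fX R d k).
Proof.
exact: (measurableT_comp measurable_fst (measurableT_comp measurable_fst
  (measurableT_comp measurable_fst measurable_fst))).
Qed.

Lemma measurable_fY0 : measurable_fun setT (@fY0 R d k).
Proof.
exact: (measurableT_comp measurable_snd (measurableT_comp measurable_fst
  (measurableT_comp measurable_fst measurable_fst))).
Qed.

Lemma measurable_fY1 : measurable_fun setT (@fY1 R d k).
Proof.
exact: (measurableT_comp measurable_snd
  (measurableT_comp measurable_fst measurable_fst)).
Qed.

Lemma measurable_fZ : measurable_fun setT (@fZ R d k).
Proof. exact: (measurableT_comp measurable_snd measurable_fst). Qed.

Lemma measurable_fXU : measurable_fun setT (@fXU R d k).
Proof. by apply: measurable_fun_pair; [exact: measurable_fX|exact: measurable_snd]. Qed.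

Lemma measurable_fY01 : measurable_fun setT (@fY01 R d k).
Proof. by apply: measurable_fun_pair; [exact: measurable_fY0|exact: measurable_fY1]. Qed.

Lemma measurable_fobs : measurable_fun setT (@fobs R d k).
Proof.
have mZ := measurable_fZ.
apply: measurable_fun_pair => //; apply: measurable_fun_pair; first exact: measurable_fX.
by apply: measurable_fun_ifT => //; [exact: measurable_fY1|exact: measurable_fY0].
Qed.

End full_data.

Section PIset_sub.
Context {R : realType} {d : nat} (P : probability (Obs R d) R)
  (e : d.-tuple R -> R) (Lam : R).
Hypothesis he : is_propensity P e.
Hypothesis e01 : forall x, 0 < e x < 1.
Hypothesis Lam1 : 1 <= Lam.

Let Lam0 : 0 < Lam. Proof. exact: lt_le_trans Lam1. Qed.

(** The constraint is the tower property given [(X, U)]. For the objective, conditional independence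
    shows that reweighting by [Z / e0] restores the law of the potential outcomes. *)
Lemma PIset_Einf m : PIset P e Lam m ->
  exists mu : probability (Obs R d * R)%type R,
  [/\ Einf P e Lam mu, forall q, measurable_fun setT q -> qconstr P mu q &
      ipw mu (@obsY R d) = m%:E].
Proof.
move=> [k [_ [Q [comp [ci [e0 [he0 ebd]]] iY1 EY1]]]].
have mX := @measurable_fX R d k; have mZ := @measurable_fZ R d k.
have mY1 := @measurable_fY1 R d k; have mC := @measurable_fXU R d k.
have mV := @measurable_fY01 R d k; have mo := @measurable_fobs R d k.
have mZs := measurable_is_true mZ.
have me0 := he0.1.
have mec : measurable_fun setT (fun c : d.-tuple R * k.-tuple R => e c.1).
  exact: (measurableT_comp he.1 measurable_fst).
(* A version of [e0] satisfying the odds-ratio bound everywhere, hence positive everywhere, as a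
   density [Z / u] requires. *)
pose u c := if Lam^-1 <= odds (e0 c) / odds (e c.1) <= Lam then e0 c else e c.1.
have uP c : msm_bound Lam (u c) (e c.1).
  rewrite /u; case: ifPn => // _.
  have := @msm_bound_tilt _ Lam (e c.1) 1 Lam0 (e01 _).
  by rewrite mulr1 addrCA subrr addr0 divr1; apply; rewrite Lam1 andbT invf_le1.
have u0 c : 0 < u c.
  have [r /andP[r0 _] ru] := msm_boundP Lam0 (e01 _) (uP c).
  have /andP[ex ex1] := e01 c.1.
  rewrite -invr_gt0 ru divr_gt0// addr_gt0// mulr_gt0 ?subr_gt0//.
  by apply: lt_le_trans r0; rewrite invr_gt0.
have mu_ : measurable_fun setT u.
  rewrite /u /odds; apply: measurable_fun_ifT => //.
  by apply: measurable_and; apply: measurable_fun_ler => //; meas.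
have hu : is_condprob Q (@fXU R d k) [set w | fZ w] u.
  apply: condprob_ae_eq he0 _ _ => //.
  by apply: filterS ebd => w hw; rewrite /u ifT.
have mui : measurable_fun setT (fun c => (u c)^-1) by meas.
have muC : measurable_fun setT (fun w : Full R d k => u (fXU w)).
  exact: (measurableT_comp mu_ mC).
have mF : measurable_fun setT (fun w : Full R d k => (fobs w, u (fXU w))).
  exact: measurable_fun_pair.
have m1 : measurable_fun setT (fun _ : Full R d k => 1 : R) by [].
have [|mu [muE muI]] := probability_with_density mF m1 (fun=> ler01) (m := Q).
  by rewrite integral_cst// mul1e; exact: probability_setT.
have {}muE A : measurable A -> mu A = Q ((fun w => (fobs w, u (fXU w))) @^-1` A).
  move=> mA; rewrite muE// integral_cst ?mul1e//; exact: measurable_preimageT.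
have {}muI (h : Obs R d * R -> \bar R) : measurable_fun setT h ->
    (\int[mu]_w h w = \int[Q]_w h (fobs w, u (fXU w)))%E.
  by move=> mh; rewrite muI//; apply: eq_integral => p _; rewrite mule1.
have mX2 : measurable_fun setT (fun w : Obs R d * R => obsX w.1).
  exact: (measurableT_comp (@measurable_obsX R d) measurable_fst).
have mZ2 : measurable_fun setT (fun w : Obs R d * R => obsZ w.1).
  exact: (measurableT_comp (@measurable_obsZ R d) measurable_fst).
have mY2 : measurable_fun setT (fun w : Obs R d * R => obsY w.1).
  exact: (measurableT_comp (@measurable_obsY R d) measurable_fst).
have meX2 : measurable_fun setT (fun w : Obs R d * R => e (obsX w.1)).
  exact: (measurableT_comp he.1 mX2).
have m2 : measurable_fun setT (fun w : Obs R d * R => w.2) by exact: measurable_snd.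
have ZE (w : Full R d k) : \1_[set w | fZ w] w = (fZ w)%:R :> R.
  rewrite indicE; suff -> : (w \in [set w | fZ w]) = fZ w by [].
  by apply/idP/idP; rewrite inE.
exists mu; split.
- split.
    move=> A mA; rewrite muE; last exact: measurable_preimageT.
    exact: comp.
  have mB : measurable [set w : Obs R d * R | Lam^-1 <= odds w.2 / odds (e (obsX w.1)) <= Lam].
    apply: measurable_is_true; rewrite /odds.
    apply: measurable_and; apply: measurable_fun_ler => //; by meas.
  exists (~` [set w : Obs R d * R | Lam^-1 <= odds w.2 / odds (e (obsX w.1)) <= Lam]); split => //.
  + exact: measurableC.
  + rewrite muE; last exact: measurableC.
    rewrite (_ : _ @^-1` _ = set0) ?measure0//; apply/seteqP; split => // w /= h.
    by apply: h; exact: (uP (fXU w)).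
- move=> q mq; rewrite /qconstr /ipw.
  have mqX2 : measurable_fun setT (fun w : Obs R d * R => q (obsX w.1)).
    exact: (measurableT_comp mq mX2).
  rewrite muI; last by meas.
  have mqX : measurable_fun setT (fun w : Obs R d => (q (obsX w))%:E).
    apply/measurable_EFinP.
    exact: (measurableT_comp mq (@measurable_obsX R d)).
  rewrite [RHS](integral_law mo (fun D mD => esym (comp D mD)) mqX).
  have mqc : measurable_fun setT (fun c : d.-tuple R * k.-tuple R => q c.1).
    exact: (measurableT_comp mq measurable_fst).
  have mh : measurable_fun setT (fun c => (q c.1 / u c)%:E) by meas.
  have := integral_condprob mC mZs hu (fun c => ltW (u0 c)) mh => E.
  etransitivity; [etransitivity; [|exact: E]|].
  + apply: eq_integral => w _; rewrite ZE -EFinM /fobs /obsX /obsZ/=.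
    by rewrite mulrAC.
  + apply: eq_integral => w _; rewrite -EFinM mulfVK//.
    by rewrite gt_eqF.
- rewrite /ipw muI; last by meas.
  rewrite -EY1.
  have mf1 : measurable_fun setT (fun w : Full R d k => (fZ w)%:R / u (fXU w)) by meas.
  have f10 (w : Full R d k) : 0 <= (fZ w)%:R / u (fXU w).
    by rewrite divr_ge0// ltW.
  have my : measurable_fun setT (fun y : R * R => y.2%:E).
    by apply/measurable_EFinP; exact: measurable_snd.
  transitivity (\int[Q]_w ((fY01 w).2%:E * ((fZ w)%:R / u (fXU w))%:E))%E.
    apply: eq_integral => w _; rewrite -EFinM /fobs /fY01 /obsY /obsZ/=.
    by case: (fZ w); rewrite ?mulrA ?mulr0 ?mul0r ?mulr0.
  transitivity (\int[Q]_w ((fY01 w).2%:E * (1 : R)%:E))%E; last first.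
    by apply: eq_integral => w _; rewrite mule1.
  (* It suffices that the density [Z / u] leaves the law of [(Y(0), Y(1))] unchanged. *)
  suff H S : measurable S ->
      (\int[Q]_(w in @fY01 R d k @^-1` S) ((fZ w)%:R / u (fXU w))%:E =
       \int[Q]_(w in @fY01 R d k @^-1` S) (1 : R)%:E)%E.
    exact: (integral_transfer mV mV mf1 m1 f10 (fun=> ler01) H my).
  move=> mS.
  rewrite [RHS]integral_cst ?mul1e//; last exact: measurable_preimageT.
  have mVS := measurable_preimageT mV mS.
  have [gS [gT [gST [hS hT hST gE]]]] := ci S [set true] mS I.
  have [gS' [hS' _ gSE]] := condprob_nneg mC hS.
  have [gT' [hT' gT0 gTE]] := condprob_nneg mC (hT : is_condprob Q (@fXU R d k) [set w | fZ w] gT).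
  have mVZ : measurable (@fY01 R d k @^-1` S `&` [set w : Full R d k | fZ w]).
    exact: measurableI.
  have [gST' [hST' gST0 gSTE]] := condprob_nneg mC
    (hST : is_condprob Q (@fXU R d k) (@fY01 R d k @^-1` S `&` [set w | fZ w]) gST).
  have mgS := hS'.1; have mgT := hT'.1; have mgST := hST'.1.
  have mgSC := measurableT_comp mgS mC.
  have mgTC := measurableT_comp mgT mC.
  have mgSTC := measurableT_comp mgST mC.
  have muiC := measurableT_comp mui mC.
  have mh1 : measurable_fun setT (fun c => ((u c)^-1)%:E) by meas.
  have mh2 : measurable_fun setT (fun c => ((u c)^-1 * gS' c)%:E) by meas.
  have E1 := integral_condprob mC mVZ hST' gST0 mh1.
  have E2 := integral_condprob mC mZs hT' gT0 mh2.
  have E3 := integral_condprob mC mZs hu (fun c => ltW (u0 c)) mh2.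
  transitivity (\int[Q]_w (((u (fXU w))^-1)%:E *
      (\1_(@fY01 R d k @^-1` S `&` [set w | fZ w]) w)%:E))%E.
    rewrite integral_mkcond; apply: eq_integral => w _.
    rewrite patchE indicI /= ZE -EFinM indicE.
    by case: ifP => _; rewrite ?mul1r ?mul0r ?mulr0// mulrC.
  rewrite E1.
  (* Conditional independence factors the joint conditional probability, up to a null set. *)
  transitivity (\int[Q]_w (((u (fXU w))^-1 * gS' (fXU w))%:E * (gT' (fXU w))%:E))%E.
    apply: ae_eq_integral => //.
    + by apply: emeasurable_funM; exact/measurable_EFinP.
    + by apply: emeasurable_funM; apply/measurable_EFinP => //; exact: measurable_funM.
    apply: filterS (filterI (filterI gE gSE) (filterI gTE gSTE)) => w.
    by move=> [[h1 h2] [h3 h4]] _; rewrite -!EFinM h4 h1 h2 h3 mulrA.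
  (* [gT'] and [u] are two versions of the conditional probability of treatment. Passing through the
     indicator of [Z] replaces one by the other without an almost sure comparison. *)
  rewrite -E2 E3.
  transitivity (\int[Q]_w (gS' (fXU w))%:E)%E.
    apply: eq_integral => w _; rewrite -EFinM mulrAC mulVf ?mul1r// gt_eqF//.
  have := hS'.2 setT measurableT; rewrite preimage_setT setIT => <-.
  by [].
Qed.

End PIset_sub.

(** * From tilts to full-data laws *)

(* Packaging the product as a probability lets it be the left factor of a further product. *)
Definition prod_probability {R : realType} {d1 d2 : measure_display}
    {T1 : measurableType d1} {T2 : measurableType d2}
    (m1 : probability T1 R) (m2 : probability T2 R) :
  probability (T1 * T2)%type R := (m1 \x m2)%E.

Lemma measurable_tuple2 {R : realType} {d : measure_display}
    {T : measurableType d} (f g : T -> R) :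
  measurable_fun setT f -> measurable_fun setT g ->
  measurable_fun setT (fun w => [tuple f w; g w]).
Proof.
move=> mf mg; apply/measurable_fun_tnthP; case=> -[|[|//]] i2.
- by rewrite (_ : _ \o _ = f)//; apply/funext => w; rewrite /= (tnth_nth 0).
- by rewrite (_ : _ \o _ = g)//; apply/funext => w; rewrite /= (tnth_nth 0).
Qed.

Section tilt_PIset.
Context {R : realType} {d : nat} (P : probability (Obs R d) R)
  (e : d.-tuple R -> R) (F : R -> d.-tuple R -> bool -> R) (Lam : R).
Hypothesis he : is_propensity P e.
Hypothesis e01 : forall x, 0 < e x < 1.
Hypothesis cdfF : is_cond_cdf P F.
Hypothesis Lam1 : 1 <= Lam.
Hypothesis iYe : P.-integrable setT (fun w => (obsY w * (obsZ w)%:R / e (obsX w))%:E).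
Variable lam : probability R R.
Hypothesis lamE : forall c : R, 0 <= c <= 1 -> lam [set v | v <= c] = c%:E.
Hypothesis lam01 : {ae lam, forall v, 0 < v < 1}.
Variable r : R -> R.
Hypothesis tr : is_tilt Lam lam r.

Let Lam0 : 0 < Lam. Proof. exact: lt_le_trans Lam1. Qed.
Let e_gt0 x : 0 < e x. Proof. by have /andP[] := e01 x. Qed.
Let e_ge0 x : 0 <= e x. Proof. exact: ltW. Qed.
Let e_le1 x : 0 <= 1 - e x.
Proof. by rewrite subr_ge0; have /andP[_ /ltW] := e01 x. Qed.
Let r_ge0 v : 0 <= r v. Proof. exact: tilt_ge0 tr. Qed.
Let mr : measurable_fun setT r. Proof. by have [] := tr. Qed.

(** An observation, of which only [X] and [Z] will be used to build full data, then the rank of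
    [Y(1)] in [w.1.2] and that of [Y(0)] in [w.2]. *)
Let W := (Obs R d * R * R)%type.
Local Notation N := (prod_probability P lam).
Local Notation beta := (N \x lam)%E.

Let mX : measurable_fun setT (fun w : W => obsX w.1.1).
Proof.
exact: (measurableT_comp (@measurable_obsX R d) (measurableT_comp measurable_fst measurable_fst)).
Qed.
Let mZ : measurable_fun setT (fun w : W => obsZ w.1.1).
Proof.
exact: (measurableT_comp (@measurable_obsZ R d) (measurableT_comp measurable_fst measurable_fst)).
Qed.
Let mv1 : measurable_fun setT (fun w : W => w.1.2).
Proof. exact: (measurableT_comp measurable_snd measurable_fst). Qed.
Let mv0 : measurable_fun setT (fun w : W => w.2).
Proof. exact: measurable_snd. Qed.
Let mr1 : measurable_fun setT (fun w : W => r w.1.2).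
Proof. exact: (measurableT_comp mr mv1). Qed.
Let meX : measurable_fun setT (fun w : W => e (obsX w.1.1)).
Proof. exact: (measurableT_comp he.1 mX). Qed.

Lemma ge0_integral_latent (c1 c0 : R) (h : d.-tuple R * R * R -> \bar R) :
  0 <= c1 -> 0 <= c0 -> measurable_fun setT h -> (forall x, 0 <= h x)%E ->
  (\int[beta]_w (h ((obsX w.1.1, w.1.2), w.2) *
     (if obsZ w.1.1 then c1 else c0 * r w.1.2)%:E) =
   \int[beta]_w (h ((obsX w.1.1, w.1.2), w.2) *
     (e (obsX w.1.1) * c1 + (1 - e (obsX w.1.1)) * (c0 * r w.1.2))%:E))%E.
Proof.
move=> c10 c00 mh h0.
have mc : measurable_fun setT (fun w : W => ((obsX w.1.1, w.1.2), w.2)).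
  by apply: measurable_fun_pair => //; exact: measurable_fun_pair.
have mhw : measurable_fun setT (fun w : W => h ((obsX w.1.1, w.1.2), w.2)).
  exact: (measurableT_comp mh mc).
rewrite [LHS](@fubini_tonelli2 _ _ _ _ _ N lam); last 2 first.
- by apply: emeasurable_funM => //; meas.
- by move=> w; rewrite mule_ge0// lee_fin; case: ifP => // _; rewrite mulr_ge0.
rewrite [RHS](@fubini_tonelli2 _ _ _ _ _ N lam); last 2 first.
- by apply: emeasurable_funM => //; meas.
- by move=> w; rewrite mule_ge0// lee_fin addr_ge0// !mulr_ge0.
apply: eq_integral => v0 _; rewrite /fubini_G/=.
have m1 : measurable_fun setT (fun _ : R => c1 : R) by [].
have m0 : measurable_fun setT (fun v : R => c0 * r v) by meas.
have mhv : measurable_fun setT (fun p : d.-tuple R * R => h (p, v0)).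
  exact: (measurableT_comp mh (@measurable_pair2 _ _ _ _ v0)).
exact: (integral_propensity_prod he e01 lam m1 m0 (fun=> c10)
  (fun v => mulr_ge0 c00 (r_ge0 v)) mhv).
Qed.

(** Treated units keep a uniform rank of [Y(1)] because that outcome is observed; only among the
    untreated is its law free. *)
Definition latent_weight (w : W) : R := if obsZ w.1.1 then 1 else r w.1.2.

Lemma latent_weight_ge0 w : 0 <= latent_weight w.
Proof. by rewrite /latent_weight; case: ifP. Qed.

Lemma measurable_latent_weight : measurable_fun setT latent_weight.
Proof. by rewrite /latent_weight; meas. Qed.

(** The rank of [Y(0)] integrates out, and given [X] and the rank of [Y(1)] the weight averages over
    [Z] to [e + (1 - e) * r]. *)
Lemma integral_latent_treated (h : d.-tuple R * R -> \bar R) : measurable_fun setT h ->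
  (\int[beta]_w (h (obsX w.1.1, w.1.2) * (latent_weight w)%:E) =
   \int[P \x lam]_p (h (obsX p.1, p.2) * (tiltw e r p)%:E))%E.
Proof.
move=> mh.
have mc1 : measurable_fun setT (fun w : W => (obsX w.1.1, w.1.2)) by exact: measurable_fun_pair.
have mXp : measurable_fun setT (fun p : Obs R d * R => obsX p.1).
  exact: (measurableT_comp (@measurable_obsX R d) measurable_fst).
have mc2 : measurable_fun setT (fun p : Obs R d * R => (obsX p.1, p.2)).
  by apply: measurable_fun_pair => //; exact: measurable_snd.
have mt := measurable_tiltw he tr.
suff H D : measurable D ->
    (\int[beta]_(w in (fun w : W => (obsX w.1.1, w.1.2)) @^-1` D) (latent_weight w)%:E =
     \int[P \x lam]_(p in (fun p : Obs R d * R => (obsX p.1, p.2)) @^-1` D) (tiltw e r p)%:E)%E.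
  exact: (integral_transfer mc1 mc2 measurable_latent_weight mt latent_weight_ge0
    (fun p => ltW (tiltw_gt0 e01 Lam1 p tr)) H mh).
move=> mD.
have mD1 : measurable_fun setT (\1_D : d.-tuple R * R -> R) by exact: measurable_indic.
have mDx : measurable_fun setT (fun x : d.-tuple R * R * R => (\1_D x.1 : R)%:E).
  by apply/measurable_EFinP; exact: (measurableT_comp mD1 measurable_fst).
have D0 (x : d.-tuple R * R * R) : (0 <= (\1_D x.1 : R)%:E)%E by rewrite lee_fin.
have E := ge0_integral_latent ler01 ler01 mDx D0.
transitivity (\int[beta]_w ((\1_D (obsX w.1.1, w.1.2) : R)%:E *
     (if obsZ w.1.1 then 1 else 1 * r w.1.2)%:E))%E.
  rewrite integral_mkcond; apply: eq_integral => w _; rewrite patchE indicE.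
  rewrite -[w \in _]/((obsX w.1.1, w.1.2) \in D) /latent_weight mul1r.
  by case: ifP => _; rewrite ?mul1e ?mul0e.
rewrite [LHS]E.
have mDp : measurable_fun setT (fun p : Obs R d * R => (\1_D (obsX p.1, p.2) : R)).
  exact: (measurableT_comp mD1 mc2).
have mDw : measurable_fun setT (fun w : W => (\1_D (obsX w.1.1, w.1.2) : R)).
  exact: (measurableT_comp mD1 mc1).
rewrite [LHS](@fubini_tonelli2 _ _ _ _ _ N lam)/=; last 2 first.
- by apply: emeasurable_funM; meas.
- by move=> w; rewrite -EFinM lee_fin mulr_ge0// addr_ge0// !mulr_ge0.
rewrite [RHS]integral_mkcond.
transitivity (\int[lam]__ (\int[P \x lam]_p (\1_D (obsX p.1, p.2) * tiltw e r p)%:E))%E.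
  apply: eq_integral => v0 _; rewrite /fubini_G/=; apply: eq_integral => p _.
  by rewrite -EFinM /tiltw mulr1 mul1r.
rewrite integral_cst// [X in (_ * X)%E](_ : _ = 1%E) ?mule1; last exact: probability_setT.
apply: eq_integral => p _; rewrite patchE indicE.
rewrite -[p \in _]/((obsX p.1, p.2) \in D).
by case: ifP => _; rewrite ?mul1r ?mul0r.
Qed.

Definition latent (w : W) : Full R d 2 :=
  ((((obsX w.1.1, qtf F w.2 (obsX w.1.1) false), qtf F w.1.2 (obsX w.1.1) true),
    obsZ w.1.1), [tuple w.2; w.1.2]).

Let mq z : measurable_fun setT (fun p : d.-tuple R * R => qtf F p.2 p.1 z).
Proof. exact: measurable_qtf cdfF z. Qed.

Lemma measurable_latent : measurable_fun setT latent.
Proof.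
apply: measurable_fun_pair.
  apply: measurable_fun_pair => //; apply: measurable_fun_pair.
    apply: measurable_fun_pair => //.
    have m := measurable_fun_pair mX mv0.
    exact: (measurableT_comp (mq false) m).
  have m := measurable_fun_pair mX mv1.
  exact: (measurableT_comp (mq true) m).
exact: measurable_tuple2 mv0 mv1.
Qed.

Lemma integral_latent_weight : (\int[beta]_w (latent_weight w)%:E = 1)%E.
Proof.
have m1 : measurable_fun setT (fun _ : d.-tuple R * R => 1%E : \bar R) by [].
under eq_integral do rewrite -[_%:E]mul1e.
rewrite (integral_latent_treated m1).
have m1' : measurable_fun setT (fun _ : Obs R d => 1%E : \bar R) by [].
rewrite (integral_tiltw_fst he e01 Lam1 tr m1').
by rewrite integral_cst// mul1e; exact: probability_setT.
Qed.

(** For treated units the observation is [resample] at the rank of [Y(1)], with weight 1, and the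
    other rank integrates out. For untreated units it is [resample] at the rank of [Y(0)],
    independent of the weight [r], whose mean is 1. *)
Lemma latent_compatible A : measurable A ->
  (\int[beta]_(w in latent @^-1` (@fobs R d 2 @^-1` A)) (latent_weight w)%:E = P A)%E.
Proof.
move=> mA.
have mA1 : measurable_fun setT (\1_A : Obs R d -> R) by exact: measurable_indic.
have mAl : measurable_fun setT (fun w : W => \1_A (fobs (latent w)) : R).
  exact: (measurableT_comp mA1 (measurableT_comp measurable_fobs measurable_latent)).
have mw := measurable_latent_weight.
have mres := measurable_resample cdfF.
have mAr : measurable_fun setT (fun p : Obs R d * R => \1_A (resample F p) : R).
  exact: (measurableT_comp mA1 mres).
rewrite integral_mkcond.
transitivity (\int[beta]_w (\1_A (fobs (latent w)) * latent_weight w)%:E)%E.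
  apply: eq_integral => w _; rewrite patchE indicE.
  rewrite -[w \in _]/(fobs (latent w) \in A).
  by case: ifP => _; rewrite ?mul1r ?mul0r.
rewrite [LHS](@fubini_tonelli1 _ _ _ _ _ N lam)/=; last 2 first.
- by meas.
- by move=> w; rewrite lee_fin mulr_ge0// latent_weight_ge0.
rewrite [LHS](@fubini_tonelli1 _ _ _ _ _ P lam)/=; last 2 first.
- apply: measurable_fun_fubini_tonelli_F; first by meas.
  by move=> w; rewrite lee_fin mulr_ge0// latent_weight_ge0.
- move=> p; apply: integral_ge0 => v _.
  by rewrite lee_fin mulr_ge0// latent_weight_ge0.
rewrite (resample_law cdfF lamE lam01 mA) -[X in _ = _ X]setIT -integral_indic//; last first.
  exact: measurable_preimageT.
rewrite [RHS](@fubini_tonelli1 _ _ _ _ _ P lam)/=; last 2 first.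
- by apply/measurable_EFinP.
- by move=> p; rewrite lee_fin.
apply: eq_integral => o _; rewrite /fubini_F/= /latent_weight/=.
case: (boolP (obsZ o)) => Zo.
  apply: eq_integral => v1 _.
  under eq_integral => v0 _.
    rewrite mulr1 (_ : fobs _ = resample F (o, v1)); last first.
      by rewrite /fobs /resample /latent /fX /fZ /fY1/= Zo.
    over.
  by rewrite integral_cst// [X in (_ * X)%E](_ : _ = 1%E) ?mule1//; exact: probability_setT.
have mAo : measurable_fun setT (fun v : R => (\1_A (resample F (o, v)) : R)%:E).
  by apply/measurable_EFinP; exact: (measurableT_comp mAr (@measurable_pair1 _ _ _ _ o)).
transitivity (\int[lam]_v1 ((\int[lam]_v0 (\1_A (resample F (o, v0)) : R)%:E) * (r v1)%:E))%E.
  apply: eq_integral => v1 _.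
  rewrite -ge0_integralZr//; last by rewrite lee_fin.
  apply: eq_integral => v0 _; rewrite -EFinM (_ : fobs _ = resample F (o, v0))//.
  by rewrite /fobs /resample /latent /fX /fZ /fY0/= (negbTE Zo).
have [_ _ ir] := tr.
rewrite ge0_integralZl//.
- by rewrite ir mule1.
- exact/measurable_EFinP.
- by move=> v _; rewrite lee_fin.
- by apply: integral_ge0 => v _; rewrite lee_fin.
Qed.

(** Bayes' rule: at a given [X], the rank of [Y(1)] has density 1 among the treated and [r] among
    the untreated. *)
Definition latent_propensity (c : d.-tuple R * 2.-tuple R) : R :=
  e c.1 / (e c.1 + (1 - e c.1) * r (tnth c.2 1)).

Let phi (c : d.-tuple R * 2.-tuple R) : R * R :=
  (qtf F (tnth c.2 0) c.1 false, qtf F (tnth c.2 1) c.1 true).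

Let mtn (i : 'I_2) : measurable_fun setT (fun c : d.-tuple R * 2.-tuple R => tnth c.2 i).
Proof. exact: (measurableT_comp (measurable_tnth i) measurable_snd). Qed.

Let mphi : measurable_fun setT phi.
Proof.
have mc1 : measurable_fun setT (fun c : d.-tuple R * 2.-tuple R => c.1) by exact: measurable_fst.
by apply: measurable_fun_pair;
  [exact: (measurableT_comp (mq false) (measurable_fun_pair mc1 (mtn 0)))|
   exact: (measurableT_comp (mq true) (measurable_fun_pair mc1 (mtn 1)))].
Qed.

Lemma measurable_latent_propensity : measurable_fun setT latent_propensity.
Proof.
have mec : measurable_fun setT (fun c : d.-tuple R * 2.-tuple R => e c.1).
  exact: (measurableT_comp he.1 measurable_fst).
have mrc : measurable_fun setT (fun c : d.-tuple R * 2.-tuple R => r (tnth c.2 1)).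
  exact: (measurableT_comp mr (mtn 1)).
by rewrite /latent_propensity; meas.
Qed.

(** The constants [c1] and [c0] treat all events in [Z] at once. With [p] the latent propensity, the
    identity behind it is [e * c1 + (1 - e) * c0 * r = (p * c1 + (1 - p) * c0) * (e + (1 - e) *
    r)]. *)
Lemma latent_condprob (c1 c0 : R) D : 0 <= c1 -> 0 <= c0 -> measurable D ->
  (\int[beta]_(w in latent @^-1` (@fXU R d 2 @^-1` D))
     ((if obsZ w.1.1 then c1 else c0) * latent_weight w)%:E =
   \int[beta]_(w in latent @^-1` (@fXU R d 2 @^-1` D))
     ((latent_propensity (fXU (latent w)) * c1 +
       (1 - latent_propensity (fXU (latent w))) * c0) * latent_weight w)%:E)%E.
Proof.
move=> c10 c00 mD.
have mD1 : measurable_fun setT (\1_D : _ -> R) by exact: measurable_indic.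
pose C (x : d.-tuple R * R * R) : d.-tuple R * 2.-tuple R := (x.1.1, [tuple x.2; x.1.2]).
have mC : measurable_fun setT C.
  apply: measurable_fun_pair; first exact: (measurableT_comp measurable_fst measurable_fst).
  apply: measurable_tuple2; first exact: measurable_snd.
  exact: (measurableT_comp measurable_snd measurable_fst).
have mDC : measurable_fun setT (fun x => \1_D (C x) : R) by exact: (measurableT_comp mD1 mC).
have mpC : measurable_fun setT (fun x => latent_propensity (C x)).
  exact: (measurableT_comp measurable_latent_propensity mC).
have p01 c : 0 <= latent_propensity c <= 1.
  have [ex ex1] := (e_ge0 c.1, e_le1 c.1).
  have w0 : 0 < e c.1 + (1 - e c.1) * r (tnth c.2 1) by apply: ltr_pwDl; rewrite ?mulr_ge0.
  rewrite /latent_propensity divr_ge0 ?(ltW w0)//= ler_pdivrMr// mul1r lerDl.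
  exact: mulr_ge0.
have mk f : (\int[beta]_(w in latent @^-1` (@fXU R d 2 @^-1` D)) (f w)%:E =
    \int[beta]_w (\1_D (C ((obsX w.1.1, w.1.2), w.2)) * f w)%:E)%E.
  rewrite integral_mkcond; apply: eq_integral => w _; rewrite patchE indicE.
  rewrite -[w \in _]/(C ((obsX w.1.1, w.1.2), w.2) \in D).
  by case: ifP => _; rewrite ?mul1r ?mul0r.
rewrite !mk.
have mh1 : measurable_fun setT (fun x => (\1_D (C x) : R)%:E) by meas.
have h10 x : (0 <= (\1_D (C x) : R)%:E)%E by rewrite lee_fin.
pose h2 x := (\1_D (C x) * (latent_propensity (C x) * c1 + (1 - latent_propensity (C x)) * c0))%:E.
have mh2 : measurable_fun setT h2 by rewrite /h2; meas.
have h20 x : (0 <= h2 x)%E.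
  have /andP[p0 p1] := p01 (C x).
  by rewrite /h2 lee_fin mulr_ge0// addr_ge0// mulr_ge0// subr_ge0.
have E1 := ge0_integral_latent c10 c00 mh1 h10.
have E2 := ge0_integral_latent ler01 ler01 mh2 h20.
transitivity (\int[beta]_w ((\1_D (C ((obsX w.1.1, w.1.2), w.2)) : R)%:E *
     (if obsZ w.1.1 then c1 else c0 * r w.1.2)%:E))%E.
  apply: eq_integral => w _; rewrite -EFinM /latent_weight.
  by case: (obsZ w.1.1); rewrite ?mulr1.
rewrite [LHS]E1.
transitivity (\int[beta]_w (h2 ((obsX w.1.1, w.1.2), w.2) *
     (if obsZ w.1.1 then 1 else 1 * r w.1.2)%:E))%E; last first.
  apply: eq_integral => w _; rewrite /h2 -EFinM /latent_weight mul1r.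
  by rewrite -mulrA.
rewrite [RHS]E2; apply: eq_integral => w _; rewrite /h2 -!EFinM; congr _%:E.
rewrite -mulrA; congr (_ * _).
rewrite /latent_propensity /C/= !(tnth_nth 0)/=.
have w0 : 0 < e (obsX w.1.1) + (1 - e (obsX w.1.1)) * r w.1.2.
  by apply: ltr_pwDl; rewrite ?mulr_ge0.
by field; rewrite gt_eqF.
Qed.

Lemma tilt_PIset : PIset P e Lam (fine (tilt_val P e F lam r)).
Proof.
have mL := measurable_latent; have mw := measurable_latent_weight.
have [Q [QE QI]] := probability_with_density mL mw latent_weight_ge0 integral_latent_weight.
have fv := tilt_val_fin_num he e01 cdfF Lam1 iYe lamE lam01 tr.
have mY1 := @measurable_fY1 R d 2; have mZ' := @measurable_fZ R d 2.
have mC := @measurable_fXU R d 2; have mV := @measurable_fY01 R d 2.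
have mp := measurable_latent_propensity.
(* Stated for general [g] so as to give integrability with the norm and the mean with the
   identity. *)
have IY (g : R -> R) : measurable_fun setT g ->
    (\int[Q]_w (g (fY1 w))%:E = \int[P \x lam]_p (g (treated F p) * tiltw e r p)%:E)%E.
  move=> mg; have mgY : measurable_fun setT (fun w : Full R d 2 => (g (fY1 w))%:E).
    by apply/measurable_EFinP; exact: (measurableT_comp mg mY1).
  rewrite QI//.
  have mh : measurable_fun setT (fun p : d.-tuple R * R => (g (qtf F p.2 p.1 true))%:E).
    by apply/measurable_EFinP; exact: (measurableT_comp mg (mq true)).
  exact: (integral_latent_treated mh).
exists 2; split => //; exists Q; split.
- move=> A mA; rewrite QE; first exact: latent_compatible.
  by apply: measurable_preimageT => //; exact: measurable_fobs.
- have condT (T : set bool) : is_condprob Q (@fXU R d 2) (@fZ R d 2 @^-1` T)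
      (fun c => latent_propensity c * \1_T true + (1 - latent_propensity c) * \1_T false).
    split; first by meas.
    move=> D mD; have mCD := measurable_preimageT mC mD.
    have mT : measurable (@fZ R d 2 @^-1` T) by exact: measurable_preimageT.
    have mpC := measurableT_comp mp mC.
    rewrite QE; last exact: measurableI.
    rewrite [RHS]integral_mkcond QI; last first.
      by apply/(measurable_restrictT _ _).1 => //; apply/measurable_funTS; meas.
    have := latent_condprob (c1 := \1_T true) (c0 := \1_T false) _ _ mD => E.
    rewrite preimage_setI setIC integral_mkcondr.
    etransitivity; [etransitivity; [|exact: E]|].
    + apply: eq_integral => w _; rewrite patchE.
      rewrite -[w \in _]/(obsZ w.1.1 \in T).
      by case: (obsZ w.1.1); rewrite !indicE; case: (_ \in T); rewrite ?mul1r ?mul0r.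
    + rewrite [LHS]integral_mkcond; apply: eq_integral => w _; rewrite !patchE.
      rewrite -[w \in _]/(fXU (latent w) \in D) -[latent w \in _]/(fXU (latent w) \in D).
      by case: ifP => _; rewrite ?mul0e// EFinM.
  split.
    (* The potential outcomes are the function [phi] of [(X, U)], so an indicator is their
       conditional probability and the joint one factors exactly. *)
    move=> S T mS mT; pose gS c : R := \1_S (phi c).
    pose gT c := latent_propensity c * \1_T true + (1 - latent_propensity c) * \1_T false.
    have mpS : measurable (phi @^-1` S) by exact: measurable_preimageT.
    have mgS : measurable_fun setT gS.
      by apply: (measurableT_comp _ mphi); exact: measurable_indic.
    have mgT : measurable_fun setT gT by rewrite /gT; meas.
    have Qphi A : measurable A -> Q (@fY01 R d 2 @^-1` S `&` A) =
        Q (A `&` @fXU R d 2 @^-1` (phi @^-1` S)).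
      move=> mA; rewrite !QE; last 2 first.
      + by apply: measurableI => //; exact: measurable_preimageT.
      + by apply: measurableI => //; exact: measurable_preimageT.
      rewrite setIC; congr (\int[_]_(w in _) _)%E.
    exists gS, gT, (fun c => gS c * gT c); split => //.
    + split => // D mD; have mCD := measurable_preimageT mC mD.
      rewrite Qphi// setIC -integral_indic//.
      exact: measurable_preimageT.
    + split; first by meas.
      move=> D mD; have mCD := measurable_preimageT mC mD.
      have mT' : measurable (@fZ R d 2 @^-1` T) by exact: measurable_preimageT.
      rewrite -setIA Qphi; last exact: measurableI.
      rewrite -setIA -preimage_setI (condT T).2; last exact: measurableI.
      rewrite preimage_setI integral_mkcondr; apply: eq_integral => w _.
      rewrite patchE /gS [\1_S _]indicE -[w \in _]/(phi (fXU w) \in S).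
      by case: ifP => _; rewrite ?mul1r ?mul0r.
    + exact: aeW.
  exists latent_propensity; split.
    have := condT [set true]; rewrite (_ : (fun c => _) = latent_propensity)//.
    apply/funext => c; rewrite !indicE mem_set// memNset//= mulr1 mulr0 addr0.
    by [].
  apply: aeW => w; rewrite /latent_propensity; apply: msm_bound_tilt => //.
  by have [_ + _] := tr; exact.
- apply/integrableP; split; first exact/measurable_EFinP.
  rewrite (IY Num.norm)//.
  have /integrableP[_] := integrable_treated_tiltw he e01 cdfF Lam1 iYe lamE lam01 tr.
  apply: le_lt_trans; rewrite le_eqVlt; apply/orP; left; apply/eqP.
  apply: eq_integral => p _ /=; rewrite normrM.
  by rewrite (gtr0_norm (tiltw_gt0 e01 Lam1 p tr)).
- by rewrite fineK// (IY id).
Qed.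

End tilt_PIset.

(** * The partially identified interval *)

Lemma integral_step {R : realType} (lam : probability R R) (a b t : R) :
  (forall c : R, 0 <= c <= 1 -> lam [set v | v <= c] = c%:E) ->
  0 <= a -> 0 <= b -> 0 <= t <= 1 ->
  (\int[lam]_v (if v <= t then b else a)%:E = (b * t + a * (1 - t))%:E)%E.
Proof.
move=> lamE a0 b0 t01.
have mle : measurable_fun setT (fun v : R => v <= t) by exact: measurable_fun_ler.
have mlt : measurable_fun setT (fun v : R => t < v) by exact: measurable_fun_ltr.
transitivity (\int[lam]_v (b%:E * ((v <= t)%R%:R : R)%:E + a%:E * ((t < v)%R%:R : R)%:E))%E.
  apply: eq_integral => v _; rewrite -!EFinM -EFinD; congr _%:E.
  by case: (leP v t) => _; rewrite ?mulr1 ?mulr0 ?addr0 ?add0r.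
rewrite ge0_integralD//; last 4 first.
- by move=> v _; rewrite -EFinM lee_fin mulr_ge0.
- by apply: emeasurable_funM; meas.
- by move=> v _; rewrite -EFinM lee_fin mulr_ge0.
- by apply: emeasurable_funM; meas.
have mle' : measurable_fun setT (fun v : R => ((v <= t)%R%:R : R)%:E) by meas.
have mlt' : measurable_fun setT (fun v : R => ((t < v)%R%:R : R)%:E) by meas.
rewrite ge0_integralZl// ge0_integralZl//.
rewrite !integral_boolR// !setIT.
transitivity (b%:E * t%:E + a%:E * (1 - t)%:E)%E; last by rewrite -!EFinM -EFinD.
by congr (_ * _ + _ * _)%E; [exact: lamE|exact: lam_gt].
Qed.

Section bounds.
Context {R : realType} {d : nat} (P : probability (Obs R d) R)
  (e : d.-tuple R -> R) (F : R -> d.-tuple R -> bool -> R) (Lam : R).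

Lemma PIset_bounds : is_propensity P e -> (forall x, 0 < e x < 1) ->
  P.-integrable setT (fun w => (obsY w * (obsZ w)%:R / e (obsX w))%:E) ->
  is_cond_cdf P F -> 1 <= Lam ->
  let tau := Lam / (Lam + 1) in
  exists psim psip : R,
    [/\ PIset P e Lam = [set m | psim <= m <= psip],
        (exists mu, [/\ Einf P e Lam mu,
                        qconstr P mu (fun x => Qt F (1 - tau) x true) &
                        ipw mu (@obsY R d) = psim%:E]),
        (forall mu, Einf P e Lam mu ->
                    qconstr P mu (fun x => Qt F (1 - tau) x true) ->
                    (psim%:E <= ipw mu (@obsY R d))%E),
        (exists mu, [/\ Einf P e Lam mu,
                        qconstr P mu (fun x => Qt F tau x true) &
                        ipw mu (@obsY R d) = psip%:E]) &
        (forall mu, Einf P e Lam mu ->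
                    qconstr P mu (fun x => Qt F tau x true) ->
                    (ipw mu (@obsY R d) <= psip%:E)%E)].
Proof.
move=> he e01 iYe cdfF Lam1 tau.
have [lam [lamE lam01]] := uniform01 R.
have Lam0 : 0 < Lam by exact: lt_le_trans Lam1.
have Lam10 : 0 < Lam + 1 by rewrite addr_gt0.
have tau0 : 0 < tau by rewrite divr_gt0.
have tau1 : tau < 1 by rewrite ltr_pdivrMr// mul1r ltrDl.
have tauC : 1 - tau = (Lam + 1)^-1 by rewrite /tau; field; rewrite gt_eqF.
have tau01 : 0 < tau < 1 by rewrite tau0.
have tauC01 : 0 < 1 - tau < 1 by rewrite subr_gt0 tau1 gtrBl.
have LamV1 : Lam^-1 <= 1 by rewrite invf_le1.
have LamV0 : 0 <= Lam^-1 by rewrite invr_ge0 ltW.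
have LamVL : Lam^-1 <= Lam by exact: le_trans Lam1.
have LL : Lam^-1 <= Lam <= Lam by rewrite LamVL lexx.
have VL : Lam^-1 <= Lam^-1 <= Lam by rewrite LamVL lexx.
have step_tilt a b t : Lam^-1 <= a <= Lam -> Lam^-1 <= b <= Lam -> 0 < t < 1 ->
    b * t + a * (1 - t) = 1 -> is_tilt Lam lam (fun v => if v <= t then b else a).
  move=> /andP[a1 a2] /andP[b1 b2] /andP[t0 t1] E; split.
  - by apply: measurable_fun_ifT => //; exact: measurable_fun_ler.
  - by move=> v; case: ifP => _; rewrite ?a1 ?b1.
  - rewrite integral_step ?E//; [exact: le_trans a1|exact: le_trans b1|].
    by rewrite !ltW.
(* The maximum puts the largest tilt on the high ranks, the minimum on the low ones; the thresholds
   make both means equal to 1. *)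
pose rp (v : R) := if v <= tau then Lam^-1 else Lam.
pose rm (v : R) := if v <= 1 - tau then Lam else Lam^-1.
have tp : is_tilt Lam lam rp.
  by apply: step_tilt => //; rewrite tauC /tau; field; rewrite !gt_eqF.
have tm : is_tilt Lam lam rm.
  by apply: step_tilt => //; rewrite subKr tauC /tau; field; rewrite !gt_eqF.
have fin r : is_tilt Lam lam r -> tilt_val P e F lam r \is a fin_num.
  by move=> tr; exact: (tilt_val_fin_num he e01 cdfF Lam1 iYe lamE lam01 tr).
have [fp fm] := (fin _ tp, fin _ tm).
have upper mu : Einf P e Lam mu -> qconstr P mu (fun x => Qt F tau x true) ->
    (ipw mu (@obsY R d) <= tilt_val P e F lam rp)%E.
  move=> muE muq; rewrite -[leLHS]mul1e -[leRHS]mul1e.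
  apply: (ipw_le he e01 cdfF Lam1 iYe lamE lam01 tau01 muE) => //; first by left.
  by move=> r /andP[? ?]; rewrite !mul1r.
have lower mu : Einf P e Lam mu -> qconstr P mu (fun x => Qt F (1 - tau) x true) ->
    (tilt_val P e F lam rm <= ipw mu (@obsY R d))%E.
  (* The minimum is the bound with [s = -1], where the roles of [Lam] and [Lam^-1] are exchanged. *)
  move=> muE muq; rewrite -leeN2 -mulN1e -[leRHS]mulN1e -EFinN.
  apply: (ipw_le he e01 cdfF Lam1 iYe lamE lam01 tauC01 muE) => //; first by right.
  by move=> r /andP[? ?]; rewrite !mulN1r !lerN2.
have mQ t : 0 < t < 1 -> measurable_fun setT (fun x => Qt F t x true).
  by move=> t01; exact: measurable_Qt cdfF _ t01.
have attained r t : is_tilt Lam lam r -> 0 < t < 1 ->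
    exists mu, [/\ Einf P e Lam mu, qconstr P mu (fun x => Qt F t x true) &
      ipw mu (@obsY R d) = (fine (tilt_val P e F lam r))%:E].
  move=> tr t01; have [mu [muE muq muY]] := tilt_Einf he e01 cdfF Lam1 lamE lam01 tr.
  exists mu; split => //; first exact: (muq _ (mQ _ t01)).
  by rewrite muY fineK//; exact: fin.
exists (fine (tilt_val P e F lam rm)), (fine (tilt_val P e F lam rp)); split.
- apply/seteqP; split => m /=.
    (* The law obtained satisfies the constraint for every function of [X], so a single [mu] gives
       both inequalities. *)
    move=> /(PIset_Einf he e01 Lam1)[mu [muE muq muY]].
    rewrite -!lee_fin !fineK// -muY.
    apply/andP; split; first by apply: lower => //; exact: (muq _ (mQ _ tauC01)).
    by apply: upper => //; exact: (muq _ (mQ _ tau01)).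
  move=> /andP[m1 m2].
  set a := fine (tilt_val P e F lam rm) in m1; set b := fine (tilt_val P e F lam rp) in m2.
  (* Linear interpolation between the endpoints; when they coincide the quotient is meaningless and
     [s = 0] serves. *)
  have [s s01 ->] : exists2 s, 0 <= s <= 1 & m = s * b + (1 - s) * a.
    have := le_trans m1 m2; rewrite le_eqVlt => /orP[/eqP ab|ab].
      exists 0; first by rewrite lexx ler01.
      by rewrite mul0r add0r subr0 mul1r; apply/eqP; rewrite eq_le m1 ab m2.
    have ba0 : 0 < b - a by rewrite subr_gt0.
    exists ((m - a) / (b - a)); last by field; rewrite gt_eqF.
    rewrite divr_ge0 ?subr_ge0//; last exact: ltW.
    by rewrite ler_pdivrMr// mul1r lerD2r.
  have ts := is_tilt_conv Lam1 s01 tp tm.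
  have := tilt_PIset he e01 cdfF Lam1 iYe lamE lam01 ts.
  rewrite (tilt_val_conv he e01 cdfF Lam1 iYe lamE lam01 s tp tm).
  by rewrite fineD ?fin_numM// !fineM.
- exact: attained.
- by move=> mu muE muq; rewrite fineK//; exact: lower.
- exact: attained.
- by move=> mu muE muq; rewrite fineK//; exact: upper.
Qed.

(** * Changing the propensity score on a null set *)

Lemma ae_pullback {dT : measure_display} {T : measurableType dT}
    (m : probability T R) (f : T -> Obs R d) (S : Obs R d -> Prop) :
  measurable_fun setT f -> (forall A, measurable A -> m (f @^-1` A) = P A) ->
  {ae P, forall w, S w} -> {ae m, forall w, S (f w)}.
Proof.
move=> mf mE [N [mN N0 sN]]; exists (f @^-1` N); split.
- exact: measurable_preimageT.
- by rewrite mE.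
- by move=> w h; apply: sN.
Qed.

Lemma Einf_ae (e1 e2 : d.-tuple R -> R) mu :
  {ae P, forall w, e1 (obsX w) = e2 (obsX w)} ->
  Einf P e1 Lam mu -> Einf P e2 Lam mu.
Proof.
move=> e12 [muE bnd]; split => //.
apply: filterS (filterI bnd (ae_pullback measurable_fst muE e12)) => w.
by move=> [? <-].
Qed.

Lemma PIset_ae (e1 e2 : d.-tuple R -> R) :
  {ae P, forall w, e1 (obsX w) = e2 (obsX w)} ->
  PIset P e1 Lam `<=` PIset P e2 Lam.
Proof.
move=> e12 m [k [k0 [Q [comp [ci [e0 [he0 bnd]]] iY EY]]]].
exists k; split => //; exists Q; split => //; split => //; exists e0; split => //.
apply: filterS (filterI bnd (ae_pullback measurable_fobs comp e12)) => w.
by move=> [? <-].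
Qed.

End bounds.

Theorem theorem1 (R : realType) (d : nat) (P : probability (Obs R d) R)
    (e : d.-tuple R -> R) (F : R -> d.-tuple R -> bool -> R) (Lam : R) :
  is_propensity P e ->
  {ae P, forall w, 0 < e (obsX w) < 1} ->
  P.-integrable setT (fun w => (obsY w)%:E) ->
  P.-integrable setT (fun w => (obsY w * (obsZ w)%:R / e (obsX w))%:E) ->
  is_cond_cdf P F ->
  1 <= Lam ->
  let tau := Lam / (Lam + 1) in
  exists psim psip : R,
    [/\ PIset P e Lam = [set m | psim <= m <= psip],
        (* psi^- is the attained minimum *)
        (exists mu, [/\ Einf P e Lam mu,
                        qconstr P mu (fun x => Qt F (1 - tau) x true) &
                        ipw mu (@obsY R d) = psim%:E]),
        (forall mu, Einf P e Lam mu ->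
                    qconstr P mu (fun x => Qt F (1 - tau) x true) ->
                    (psim%:E <= ipw mu (@obsY R d))%E),
        (* psi^+ is the attained maximum *)
        (exists mu, [/\ Einf P e Lam mu,
                        qconstr P mu (fun x => Qt F tau x true) &
                        ipw mu (@obsY R d) = psip%:E]) &
        (forall mu, Einf P e Lam mu ->
                    qconstr P mu (fun x => Qt F tau x true) ->
                    (ipw mu (@obsY R d) <= psip%:E)%E)].
Proof.
move=> he ae01 _ iYe cdfF Lam1 tau.
(* Overlap is assumed almost surely only. [e'] satisfies it everywhere, with an arbitrary default in
   (0, 1), and both the partially identified set and the admissible weights depend on [e] only up to
   null sets. *)
pose e' x := if 0 < e x < 1 then e x else 2^-1.
have e'01 x : 0 < e' x < 1.
  by rewrite /e'; case: ifP => // _; rewrite invr_gt0 ltr0n invf_lt1// ltr1n.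
have me := he.1.
have me' : measurable_fun setT e'.
  apply: measurable_fun_ifT => //.
  by apply: measurable_and; exact: measurable_fun_ltr.
have ee' : {ae P, forall w, e (obsX w) = e' (obsX w)}.
  by apply: filterS ae01 => w h; rewrite /e' h.
have e'e : {ae P, forall w, e' (obsX w) = e (obsX w)}.
  by apply: filterS ee' => w ->.
have mX := @measurable_obsX R d; have mY := @measurable_obsY R d.
have mZ := @measurable_obsZ R d.
have he' : is_propensity P e' by exact: condprob_ae_eq he me' e'e.
have meX := measurableT_comp me mX; have meX' := measurableT_comp me' mX.
have iYe' : P.-integrable setT (fun w => (obsY w * (obsZ w)%:R / e' (obsX w))%:E).
  have /integrableP[mi ii] := iYe.
  have mf : measurable_fun setT (fun w => obsY w * (obsZ w)%:R / e (obsX w) : R) by meas.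
  have mf' : measurable_fun setT (fun w => obsY w * (obsZ w)%:R / e' (obsX w) : R) by meas.
  apply/integrableP; split; first exact/measurable_EFinP.
  apply: le_lt_trans ii; rewrite le_eqVlt; apply/orP; left; apply/eqP.
  apply: ae_eq_integral => //; [exact: measurable_abseEFin|exact: measurable_abseEFin|].
  by apply: filterS e'e => w -> _.
have [psim [psip [PIE mini lb maxi ub]]] := PIset_bounds he' e'01 iYe' cdfF Lam1.
exists psim, psip; split.
- by rewrite -PIE; apply/seteqP; split; exact: PIset_ae.
- by have [mu [muE ? ?]] := mini; exists mu; split => //; exact: Einf_ae e'e muE.
- by move=> mu muE; apply: lb; exact: Einf_ae ee' muE.
- by have [mu [muE ? ?]] := maxi; exists mu; split => //; exact: Einf_ae e'e muE.
- by move=> mu muE; apply: ub; exact: Einf_ae ee' muE.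
Qed.
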